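(* Let $X$ and $Y$ be bounded context-free languages as described in the context, with associated interleaving set $\Pi$, direction set $D_X$ and linear programs $\mathrm{LP}_{\vec a,\pi}$ with optimal values $\mathrm{OPT}_{\vec a,\pi}$. Then \[ \overrightarrow{\mathrm{AH}}_{\mathrm{ned}}(X,Y)=\sup_{\vec a\in D_X}\ \min_{\pi\in\Pi}\ \mathrm{OPT}_{\vec a,\pi}=\sup_{\vec a\in D_X}F(\vec a),\qquad F(\vec a):=\min_{\pi\in\Pi}\mathrm{OPT}_{\vec a,\pi}. \]
   Context: Distances. An edit path from $x$ to $y$ is a sequence $p=(a_1,b_1)\cdots(a_N,b_N)$ with $(a_i,b_i)\in(\Sigma\cup\{\varepsilon\})^2\setminus\{(\varepsilon,\varepsilon)\}$, $a_1\cdots a_N=x$, $b_1\cdots b_N=y$; $|p|=N$, $\mathrm{wgt}(p)=|\{i:a_i\ne b_i\}|$; $\mathrm{ned}(x,y)=\min_p\mathrm{wgt}(p)/|p|$ ($\mathrm{ned}(\varepsilon,\varepsilon)=0$); $\overrightarrow{\mathrm{AH}}_{\mathrm{ned}}(X,Y)=\lim_{k\to\infty}\sup_{x\in X,|x|\ge k}\inf_{y\in Y}\mathrm{ned}(x,y)$ (empty sup $=0$). Languages. Fix nonempty words $x_1,\dots,x_n$ and $y_1,\dots,y_m$ over $\Sigma$, with $X\subseteq x_1^*\cdots x_n^*$ and $Y\subseteq y_1^*\cdots y_m^*$ context-free. For $\vec\nu\in\mathbb{N}^n$ let $w^X_{\vec\nu}=x_1^{\nu_1}\cdots x_n^{\nu_n}$,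 and similarly $w^Y_{\vec\mu}$ for $\vec\mu\in\mathbb{N}^m$. Let $S_X=\{\vec\nu: w^X_{\vec\nu}\in X\}$ and $S_Y=\{\vec\mu:w^Y_{\vec\mu}\in Y\}$. Assume $S_X=\{\sum_{q=1}^k t_q\vec u_q: t\in\mathbb{N}^k\}$ and $S_Y=\{\sum_{s=1}^r t_s\vec v_s:t\in\mathbb{N}^r\}$ for period vectors $\vec u_q\in\mathbb{N}^n$, $\vec v_s\in\mathbb{N}^m$ (stratified linear sets with zero constant vector). Directions. For $\vec\nu\in\mathbb{N}^n\setminus\{0\}$, $\mathrm{dir}(\vec\nu)=\vec\nu/\sum_i\nu_i|x_i|$. $D_X$ is the topological closure in $\mathbb{R}^n$ of $\{\mathrm{dir}(\vec\nu):\vec\nu\in S_X\setminus\{0\}\}$; it lies in $\{\vec d\in\mathbb{R}^n_{\ge0}:\sum_i d_i|x_i|=1\}$. Interleavings. $\Pi$ is the set of monotone lattice paths in the grid $\{1..n\}\times\{1..m\}$ from $(1,1)$ to $(n,m)$ using steps $(i,j)\to(i+1,j)$ and $(i,j)\to(i,j+1)$, each identified with its set of cells. Cyclic edit graphs. For $x_i=c_1\cdots c_{|x_i|}$, $y_j=e_1\cdots e_{|y_j|}$, the graph $G^{i,j}$ has vertex set the quotient of $\{0..|x_i|\}\times\{0..|y_j|\}$ identifying $(0,k)\sim(|x_i|,k)$ and $(l,0)\sim(l,|y_j|)$, and (multi)edges: $(l,k)\to(l+1,k)$ (deletion of $c_{l+1}$, weight 1), $(l,k)\to(l,k+1)$ (insertion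 of $e_{k+1}$, weight 1), $(l,k)\to(l+1,k+1)$ (weight $0$ if $c_{l+1}=e_{k+1}$, else 1), for all $l<|x_i|$, $k\le|y_j|$ resp. $l\le|x_i|$, $k<|y_j|$ resp. $l<|x_i|,k<|y_j|$. Write $c(e)$ for the weight; $\mathbb{1}_{x_i}(e)=1$ iff $e$ is a deletion or diagonal edge, $\mathbb{1}_{y_j}(e)=1$ iff $e$ is an insertion or diagonal edge (else $0$). Linear program $\mathrm{LP}_{\vec a,\pi}$ for $\vec a\in D_X$, $\pi\in\Pi$: variables $f^{i,j}_e\ge0$ for $(i,j)\in\pi$, $e\in E(G^{i,j})$; $\tau_s\ge0$ for $1\le s\le r$; $\lambda\in(0,1]$. With $b_j=\sum_{s=1}^r\tau_s\,(\vec v_s)_j$, constraints: (1) $\sum_{(i,j)\in\pi}\sum_e f^{i,j}_e=1$; (2) for each $(i,j)\in\pi$ and vertex $v$ of $G^{i,j}$, $\sum_{e\text{ out of }v}f^{i,j}_e=\sum_{e\text{ into }v}f^{i,j}_e$; (3) for each $i\le n$, $\sum_{j:(i,j)\in\pi}\sum_e f^{i,j}_e\mathbb{1}_{x_i}(e)=|x_i|\,a_i\,\lambda$; (4) for each $j\le m$, $\sum_{i:(i,j)\in\pi}\sum_e f^{i,j}_e\mathbb{1}_{y_j}(e)=|y_j|\,b_j$. Objective: minimize $\sum_{(i,j)\in\pi}\sum_e f^{i,j}_e c(e)$; $\mathrm{OPT}_{\vec a,\pi}$ is its optimal value. *)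

(* Defs.v *)
From HB Require Import structures.
From mathcomp Require Import all_boot all_order all_algebra.
From mathcomp Require Import all_classical all_reals all_analysis.
Set Implicit Arguments. Unset Strict Implicit. Unset Printing Implicit Defensive.
Import Order.TTheory GRing.Theory Num.Theory.
Local Open Scope classical_set_scope.
Local Open Scope ring_scope.

Inductive derives (N T : eqType) (rules : seq (N * seq (N + T)))
  : N -> seq T -> Prop :=
| der_rule A rhs w : (A, rhs) \in rules -> derives_seq rules rhs w ->
    derives rules A w
with derives_seq (N T : eqType) (rules : seq (N * seq (N + T)))
  : seq (N + T) -> seq T -> Prop :=
| ds_nil : derives_seq rules [::] [::]
| ds_term a rhs w : derives_seq rules rhs w ->
    derives_seq rules (inr a :: rhs) (a :: w)
| ds_nt A rhs u w : derives rules A u -> derives_seq rules rhs w ->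
    derives_seq rules (inl A :: rhs) (u ++ w).

Definition context_free (Sigma : finType) (L : set (seq Sigma)) : Prop :=
  exists (N : finType) (rules : seq (N * seq (N + Sigma))) (S : N),
    L = [set w | derives rules S w].

Definition edit_op (Sigma : eqType) := (option Sigma * option Sigma)%type.

Definition is_edit_path (Sigma : eqType) (p : seq (edit_op Sigma))
    (x y : seq Sigma) : Prop :=
  all (fun ab => ab != (None, None)) p /\
  pmap id (unzip1 p) = x /\ pmap id (unzip2 p) = y.

Definition wgt (Sigma : eqType) (p : seq (edit_op Sigma)) : nat :=
  count (fun ab => ab.1 != ab.2) p.

Definition ned (R : realType) (Sigma : eqType) (x y : seq Sigma) : R :=
  if (x == [::]) && (y == [::]) then 0 else
  inf [set (wgt p)%:R / (size p)%:R | p in [set p | is_edit_path p x y]].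

Definition AH_ned (R : realType) (Sigma : eqType) (X Y : set (seq Sigma)) : R :=
  limn (fun k : nat =>
    (sup [set inf [set ned R x y | y in Y] | x in [set x | X x /\ (k <= size x)%N]]
      : R^o)).

Definition wordX (Sigma : eqType) (n : nat) (xs : 'I_n -> seq Sigma)
    (nu : 'I_n -> nat) : seq Sigma :=
  flatten [seq flatten (nseq (nu i) (xs i)) | i <- enum 'I_n].

Definition linset (n k : nat) (u : 'I_k -> 'I_n -> nat) : set ('I_n -> nat) :=
  [set nu | exists t : 'I_k -> nat, forall i, nu i = (\sum_(q < k) t q * u q i)%N].

Definition stratified (n k : nat) (u : 'I_k -> 'I_n -> nat) : Prop :=
  (forall q, (#|[set i | u q i != 0%N]| <= 2)%N) /\
  (forall q q' (i j k' l : 'I_n), (i < j)%N -> (j < k')%N -> (k' < l)%N ->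
     ~ [/\ u q i != 0%N, u q k' != 0%N, u q' j != 0%N & u q' l != 0%N]).

Definition SX (Sigma : eqType) (n : nat) (xs : 'I_n -> seq Sigma)
    (X : set (seq Sigma)) : set ('I_n -> nat) :=
  [set nu | X (wordX xs nu)].

Definition dir (R : realType) (Sigma : eqType) (n : nat) (xs : 'I_n -> seq Sigma)
    (nu : 'I_n -> nat) : 'rV[R^o]_n :=
  \row_i ((nu i)%:R / (\sum_(i0 < n) (nu i0 * size (xs i0))%N)%:R).

Definition DX (R : realType) (Sigma : eqType) (n : nat) (xs : 'I_n -> seq Sigma)
    (X : set (seq Sigma)) : set 'rV[R^o]_n :=
  closure [set dir R xs nu | nu in [set nu | SX xs X nu /\ nu != (fun=> 0%N)]].

(* Interleavings: monotone lattice paths from (1,1) to (n,m) (0-based here) *)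
Definition istep (n m : nat) (c d : 'I_n * 'I_m) : bool :=
  ((val d.1 == (val c.1).+1) && (d.2 == c.2)) ||
  ((d.1 == c.1) && (val d.2 == (val c.2).+1)).

Definition is_interleaving (n m : nat) (pi : {set 'I_n * 'I_m}) : Prop :=
  exists (c0 : 'I_n * 'I_m) (s : seq ('I_n * 'I_m)),
    [/\ val c0.1 = 0%N /\ val c0.2 = 0%N, path (@istep n m) c0 s,
        val (last c0 s).1 = n.-1, val (last c0 s).2 = m.-1 &
        pi = [set c : 'I_n * 'I_m | c \in c0 :: s]%SET].

(* Cyclic edit graphs G^{i,j}.  For p = |x_i|, q = |y_j| the vertex set is
   the quotient {0..p} x {0..q} / ~, identified with Z_p x Z_q via (l,k) |->
   (l mod p, k mod q).  Edges are indexed by the unquotiented data: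
   (0,l,k) deletion  (l<p, k<=q), (1,l,k) insertion (l<=p, k<q),
   (2,l,k) diagonal (l<p, k<q). *)
Definition edge := (nat * nat * nat)%type.

Definition edges (p q : nat) : seq edge :=
  [seq (0, l, k) | l <- iota 0 p, k <- iota 0 q.+1] ++
  [seq (1, l, k) | l <- iota 0 p.+1, k <- iota 0 q] ++
  [seq (2, l, k) | l <- iota 0 p, k <- iota 0 q].

Definition vertices (p q : nat) : seq (nat * nat) :=
  [seq (l, k) | l <- iota 0 p, k <- iota 0 q].

Definition esrc (p q : nat) (e : edge) : nat * nat :=
  let: (_, l, k) := e in (l %% p, k %% q)%N.

Definition etgt (p q : nat) (e : edge) : nat * nat :=
  let: (t, l, k) := e in
  (if t == 0 then (l.+1 %% p, k %% q)
  else if t == 1 then (l %% p, k.+1 %% q)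
  else (l.+1 %% p, k.+1 %% q))%N.

Definition ecost (Sigma : eqType) (x y : seq Sigma) (e : edge) : nat :=
  let: (t, l, k) := e in
  if t == 2%N then
    (match onth x l, onth y k with
     | Some a, Some b => if a == b then 0 else 1
     | _, _ => 1 end)%N
  else 1%N.

Definition ind_x (e : edge) : nat := let: (t, _, _) := e in nat_of_bool (t != 1%N).
Definition ind_y (e : edge) : nat := let: (t, _, _) := e in nat_of_bool (t != 0%N).

Section LP.
Context (R : realType) (Sigma : eqType) (n m r : nat)
  (xs : 'I_n -> seq Sigma) (ys : 'I_m -> seq Sigma)
  (v : 'I_r -> 'I_m -> nat).

Definition Gsz (c : 'I_n * 'I_m) := (size (xs c.1), size (ys c.2)).

Definition LP_feasible (a : 'rV[R^o]_n) (pi : {set 'I_n * 'I_m})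
    (f : 'I_n * 'I_m -> edge -> R) (tau : 'I_r -> R) (lam : R) : Prop :=
  let p c := (Gsz c).1 in let q c := (Gsz c).2 in
  let b j := \sum_(s < r) tau s * (v s j)%:R in
  [/\ [/\ (forall c e, 0 <= f c e), (forall s, 0 <= tau s) & 0 < lam <= 1],
   \sum_(c in pi) \sum_(e <- edges (p c) (q c)) f c e = 1,
   (forall c, c \in pi -> forall w, w \in vertices (p c) (q c) ->
      \sum_(e <- edges (p c) (q c) | esrc (p c) (q c) e == w) f c e =
      \sum_(e <- edges (p c) (q c) | etgt (p c) (q c) e == w) f c e),
   (forall i : 'I_n,
      \sum_(c in pi | c.1 == i) \sum_(e <- edges (p c) (q c)) f c e * (ind_x e)%:R
      = (size (xs i))%:R * a ord0 i * lam) &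
   (forall j : 'I_m,
      \sum_(c in pi | c.2 == j) \sum_(e <- edges (p c) (q c)) f c e * (ind_y e)%:R
      = (size (ys j))%:R * b j)].

Definition LP_obj (f : 'I_n * 'I_m -> edge -> R) (pi : {set 'I_n * 'I_m}) : R :=
  \sum_(c in pi) \sum_(e <- edges (Gsz c).1 (Gsz c).2)
     f c e * (ecost (xs c.1) (ys c.2) e)%:R.

Definition OPT (a : 'rV[R^o]_n) (pi : {set 'I_n * 'I_m}) : R :=
  inf [set LP_obj f pi | f in
        [set f | exists tau lam, LP_feasible a pi f tau lam]].

Definition Fmin (a : 'rV[R^o]_n) : R :=
  inf [set OPT a pi | pi in [set pi | is_interleaving pi]].

End LP.

(* Main.v *)
(* Up to additive constants, edit paths between long words and rational points
   of the linear programs are the same thing.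

   Given an edit path from a word of X to a word of Y, cutting it at the block
   boundaries of both words gives a monotone lattice path of cells and in each
   cell a walk in its cyclic edit graph.  Closing these walks and padding the
   missing contents by laps of deletions and insertions changes weight and
   length by a bounded amount plus the distance between the exponents of the
   word and the prescribed direction; dividing by the length gives a feasible
   point.  This holds for every direction, which takes care of the closure in
   the definition of the direction set.

   Conversely, a feasible flow is scaled to the length of the word and split
   into cycles, at most one per edge.  Rounding down the multiplicities and
   connecting the cycles through a base vertex gives an edit path between
   powers of the two words of each cell, with an error depending only on the
   graph; the concatenation of these paths along the interleaving is then
   corrected to the right exponents.

   Since the errors are bounded and the words become arbitrarily long, both
   estimates hold in the limit with the same value. *)

Require Import Defs.
From HB Require Import structures.
From mathcomp Require Import all_boot all_order all_algebra.
From mathcomp Require Import all_classical all_reals all_analysis.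
From mathcomp Require Import zify ring lra.
Import Order.TTheory GRing.Theory Num.Theory.
Local Open Scope classical_set_scope.
Local Open Scope ring_scope.

Set Implicit Arguments. Unset Strict Implicit. Unset Printing Implicit Defensive.

(** * Edit paths along periodic words *)

(** The two directions differ in what can be corrected. In a program the row contents are prescribed
    exactly while laps can only add content, so an edit path must be trimmed before its walks are
    closed: [n + m] periods per block suffice, because an interleaving has fewer than [n + m] cells
    and closing costs less than one period of each word in a cell. Columns are restored to the
    exponents of the actual word of [Y], since only those are known to be combinations of the period
    vectors. In the other direction the coefficients [tau] are rounded, not the exponents, so that
    the word obtained stays in [Y]; [lam] fixes the scale, a word of length [N] being matched by the
    flow times [N / lam]. Walks carry real multiplicities and near-optimal feasible points are
    enough, so neither rational nor optimal points are extracted. Since [inf] and [sup] of the empty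
    set are 0, the feasible sets, the set of interleavings and [Y] have to be shown nonempty. *)

(* A move records which of the two words gives a letter.  Positions along a walk
   are unrolled to natural numbers and reduced modulo the periods only when a
   letter or an edge is read off. *)
Definition move := (bool * bool)%type.

Definition cx (ts : seq move) : nat := count (fun m => m.1) ts.
Definition cy (ts : seq move) : nat := count (fun m => m.2) ts.

Definition proper (ts : seq move) : bool := all (fun m => m != (false, false)) ts.

(** The factor of length [a] at position [L] of the infinite power of [x]. *)
Definition cyc (Sigma : eqType) (x : seq Sigma) (L a : nat) : seq Sigma :=
  pmap id [seq onth x (i %% size x)%N | i <- iota L a].

Fixpoint lab (Sigma : eqType) (x y : seq Sigma) (ts : seq move) (L K : nat)
  : seq (edit_op Sigma) :=
  if ts is m :: ts' then
    (if m.1 then onth x (L %% size x)%N else None,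
     if m.2 then onth y (K %% size y)%N else None)
      :: lab x y ts' (L + m.1)%N (K + m.2)%N
  else [::].

Definition mtype (m : move) : nat := if m.1 then (if m.2 then 2 else 0)%N else 1%N.

(** For positive periods the reduced positions select one of the parallel copies of a glued edge:
    deletions with [k = q] and insertions with [l = p] belong to [edges] but are never traversed. *)
Fixpoint etr (p q : nat) (ts : seq move) (L K : nat) : seq edge :=
  if ts is m :: ts' then
    (mtype m, L %% p, K %% q)%N :: etr p q ts' (L + m.1)%N (K + m.2)%N
  else [::].

Section Words.
Context (Sigma : eqType).
Implicit Types (x y z : seq Sigma) (P Q : seq (edit_op Sigma)).

Lemma cycD x L a b : cyc x L (a + b) = cyc x L a ++ cyc x (L + a) b.
Proof. by rewrite /cyc iotaD map_cat pmap_cat. Qed.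

Lemma size_cyc x L a : x != [::] -> size (cyc x L a) = a.
Proof.
move=> x0; have sx : (0 < size x)%N by case: x x0.
rewrite /cyc size_pmap count_map -[RHS](size_iota L a).
apply/eqP; rewrite -all_count; apply/allP => i _ /=.
by rewrite onthTE ltn_mod.
Qed.

Lemma cycDmod x L a : cyc x (L %% size x) a = cyc x L a.
Proof.
elim: a L => // a IH L; rewrite -addn1 addnC !cycD -IH; congr cat.
  by rewrite /cyc /= modn_mod.
by rewrite -[in RHS]IH modnDml.
Qed.

Lemma cyc_lap x : cyc x 0 (size x) = x.
Proof.
have -> : cyc x 0 (size x) = pmap id [seq onth x i | i <- iota 0 (size x)].
  congr pmap; apply/eq_in_map => i; rewrite mem_iota => /andP[_ ix].
  by rewrite modn_small.
have -> : [seq onth x i | i <- iota 0 (size x)] = map Some x.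
  apply: (@eq_from_nth _ None) => [|i]; rewrite !size_map size_iota // => ix.
  by rewrite (nth_map 0%N) ?size_iota // nth_iota // add0n onthE.
by elim: x => //= a x ->.
Qed.

Lemma cyc_laps x A : x != [::] -> cyc x 0 (A * size x) = flatten (nseq A x).
Proof.
move=> x0; elim: A => // A IH.
by rewrite mulSn cycD cyc_lap add0n -(cycDmod x (size x)) modnn IH.
Qed.

Lemma cyc_split x L a x1 x2 : x != [::] -> cyc x L a = x1 ++ x2 ->
  [/\ x1 = cyc x L (size x1), x2 = cyc x (L + size x1) (size x2) &
      (a = size x1 + size x2)%N].
Proof.
move=> x0 E; have sa := congr1 size E; rewrite size_cyc // size_cat in sa.
move: E; rewrite sa cycD => /eqP; rewrite eqseq_cat ?size_cyc //.
by case/andP => /eqP <- /eqP <-; rewrite !size_cyc.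
Qed.

Lemma lab_fst x y ts L K : pmap id (unzip1 (lab x y ts L K)) = cyc x L (cx ts).
Proof.
elim: ts L K => // -[[] b] ts IH L K /=; last by rewrite IH addn0 add0n.
by rewrite IH cycD /cyc /=; case: onth.
Qed.

Lemma lab_snd x y ts L K : pmap id (unzip2 (lab x y ts L K)) = cyc y K (cy ts).
Proof.
elim: ts L K => // -[a []] ts IH L K /=; last by rewrite IH addn0 add0n.
by rewrite IH cycD /cyc /=; case: onth.
Qed.

Lemma size_lab x y ts L K : size (lab x y ts L K) = size ts.
Proof. by elim: ts L K => //= m ts IH L K; rewrite IH. Qed.

Lemma onth_mod x L : x != [::] -> onth x (L %% size x) != None.
Proof.
move=> x0; have : onth x (L %% size x)%N by rewrite onthTE ltn_mod; case: x x0.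
by case: onth.
Qed.

Lemma lab_edit_path x y ts L K : x != [::] -> y != [::] -> proper ts ->
  is_edit_path (lab x y ts L K) (cyc x L (cx ts)) (cyc y K (cy ts)).
Proof.
move=> x0 y0 pr; split; last by rewrite lab_fst lab_snd.
elim: ts L K pr => // -[a b] ts IH L K /= /andP[ab pr]; rewrite IH // andbT.
have := onth_mod L x0; have := onth_mod K y0; move: ab.
by case: a b => [] [] //; do 2!case: onth => //.
Qed.

Definition moves P : seq move := [seq (isSome ab.1, isSome ab.2) | ab <- P].

(** The positions dictate the letters, so an edit path between factors of periodic words is
    recovered from its moves alone. *)
Lemma lab_moves x y P L a K b : x != [::] -> y != [::] ->
  is_edit_path P (cyc x L a) (cyc y K b) ->
  [/\ proper (moves P), P = lab x y (moves P) L K, cx (moves P) = a &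
      cy (moves P) = b].
Proof.
move=> x0 y0; have cS z L' a' : z != [::] -> cyc z L' a'.+1 =
    pmap id [:: onth z (L' %% size z)%N] ++ cyc z L'.+1 a'.
  by move=> z0; rewrite -addn1 addnC cycD addn1.
elim: P L a K b => [| [ o1 o2] P IH] L a K b [/= pr [Ex Ey]].
  have := congr1 size Ex; have := congr1 size Ey.
  by rewrite !size_cyc //= => <- <-.
case/andP: pr => o12 pr; rewrite /cx /cy /=.
have [a' [Ea Ea1 Ex']] : exists a', [/\ a = (isSome o1 + a')%N,
   o1 = (if isSome o1 then onth x (L %% size x)%N else None) &
   pmap id (unzip1 P) = cyc x (L + isSome o1) a'].
  case: o1 {o12} Ex => [c|] /= Ex; last by exists a; rewrite addn0.
  case: a Ex => [//|a]; rewrite cS //.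
  have := onth_mod L x0; case E: onth => [c'|] //= _ [-> ->].
  by exists a; rewrite addn1.
have [b' [Eb Eb1 Ey']] : exists b', [/\ b = (isSome o2 + b')%N,
   o2 = (if isSome o2 then onth y (K %% size y)%N else None) &
   pmap id (unzip2 P) = cyc y (K + isSome o2) b'].
  case: o2 {o12 Ea1} Ey => [c|] /= Ey; last by exists b; rewrite addn0.
  case: b Ey => [//|b]; rewrite cS //.
  have := onth_mod K y0; case E: onth => [c'|] //= _ [-> ->].
  by exists b; rewrite addn1.
have [IH1 IH2 IH3 IH4] := IH _ _ _ _ (conj pr (conj Ex' Ey')).
split; rewrite ?IH1 -?IH2 -?Ea1 -?Eb1 // ?Ea ?Eb; last 2 first.
- by rewrite -IH3.
- by rewrite -IH4.
by rewrite andbT; case: (o1) (o2) o12 => [?|] [?|].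
Qed.

Lemma edit_path_cat P1 P2 x1 x2 y1 y2 : is_edit_path P1 x1 y1 ->
  is_edit_path P2 x2 y2 -> is_edit_path (P1 ++ P2) (x1 ++ x2) (y1 ++ y2).
Proof.
move=> [a1 [<- <-]] [a2 [<- <-]]; split; first by rewrite all_cat a1.
by rewrite /unzip1 /unzip2 !map_cat !pmap_cat.
Qed.

Definition eswap P := [seq (ab.2, ab.1) | ab <- P].

Lemma eswap_edit_path P x y : is_edit_path P x y -> is_edit_path (eswap P) y x.
Proof.
move=> [a [<- <-]]; split; first by rewrite all_map; apply: sub_all a => -[[?|] [?|]].
by rewrite /unzip1 /unzip2 -!map_comp.
Qed.

Lemma size_eswap P : size (eswap P) = size P.
Proof. by rewrite size_map. Qed.

Lemma wgt_eswap P : wgt (eswap P) = wgt P.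
Proof. by rewrite /wgt count_map; apply: eq_count => ab /=; rewrite eq_sym. Qed.

Lemma eswapK P : eswap (eswap P) = P.
Proof. by rewrite /eswap -map_comp map_id_in // => -[]. Qed.

Lemma wgt_cat P Q : wgt (P ++ Q) = (wgt P + wgt Q)%N.
Proof. exact: count_cat. Qed.

Lemma wgt_size P : (wgt P <= size P)%N.
Proof. exact: count_size. Qed.

Lemma edit_path_split P x1 x2 y : is_edit_path P (x1 ++ x2) y ->
  exists P1 P2 y1 y2, [/\ P = P1 ++ P2, y = y1 ++ y2, is_edit_path P1 x1 y1 &
    is_edit_path P2 x2 y2].
Proof.
elim: P x1 y => [| [ o1 o2] P IH] [|a x1] y /=.
- by move=> H; exists [::], [::], [::], y; split => //; exact: H.
- by case=> _ [].

- move=> H; exists [::], ((o1, o2) :: P), [::], y; split => //; exact: H.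
case=> /= /andP[ o12 pr] [Ex Ey].
have [x1' [Ex1 Ex']] : exists x1', pmap id (unzip1 P) = x1' ++ x2 /\ (a :: x1 = pmap id [:: o1] ++ x1').
  case: o1 {o12} Ex => [c|] /=; last by exists (a :: x1).
  by case=> -> E; exists x1.
have [P1 [P2 [y1 [y2 [E1 E2 H1 H2]]]]] := IH _ _ (conj pr (conj Ex1 erefl)).
exists ((o1, o2) :: P1), P2, (pmap id [:: o2] ++ y1), y2; split => //.
- by rewrite E1.
- by rewrite -catA -E2 -Ey; case: (o2).
rewrite Ex'; apply: (@edit_path_cat [:: (o1, o2)] P1 _ x1' _ y1) => //.
by split => //=; rewrite o12.
Qed.

Lemma edit_path_splitr P x y1 y2 : is_edit_path P x (y1 ++ y2) ->
  exists P1 P2 x1 x2, [/\ P = P1 ++ P2, x = x1 ++ x2, is_edit_path P1 x1 y1 &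
    is_edit_path P2 x2 y2].
Proof.
move=> /eswap_edit_path /edit_path_split [P1 [P2 [x1 [x2 [E1 E2 H1 H2]]]]].
exists (eswap P1), (eswap P2), x1, x2; split => //; try exact: eswap_edit_path.
by rewrite -[P]eswapK E1 /eswap map_cat.
Qed.

(** When a letter of [x] is removed, a pair containing it becomes an insertion and a deletion of it
    disappears. Either changes weight and length by at most one in the unfavourable direction. *)
Lemma edit_path_subseq P x' x y : subseq x' x -> is_edit_path P x y ->
  exists P', [/\ is_edit_path P' x' y, (wgt P' <= wgt P + (size x - size x'))%N &
    (size P <= size P' + (size x - size x'))%N].
Proof.
elim: P x' x y => [| [ o1 o2] P IH] x' x y sx [/= pr [Ex Ey]].
  move: sx; rewrite -Ex subseq0 => /eqP ->.
  by exists [::]; split => //; split => //; rewrite -Ey.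
case/andP: pr => o12 pr; case: o1 o12 Ex => [c|] o12 /= Ex; last first.
  have [P' [H1 H2 H3]] := IH _ _ _ sx (conj pr (conj Ex erefl)).
  exists ((None, o2) :: P'); split; last 2 first.
  - by rewrite /wgt /= -addnA leq_add2l.
  - by rewrite /= addSn ltnS.
  case: H1 => a [b d]; split; first by rewrite /= ?o12 ?a.
  by rewrite /= b d Ey.
rewrite -Ex in sx *.
have Kcase x1 : x' = c :: x1 -> subseq x1 (pmap id (unzip1 P)) ->
  exists P', [/\ is_edit_path P' x' y,
   (wgt P' <= (Some c != o2) + wgt P + (size (c :: pmap id (unzip1 P)) - size x'))%N &
    (size P < size P' + (size (c :: pmap id (unzip1 P)) - size x'))%N].
  move=> -> sx1; have [P' [H1 H2 H3]] := IH _ _ _ sx1 (conj pr (conj erefl erefl)).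
  exists ((Some c, o2) :: P'); split; last 2 first.
  - by rewrite /wgt /= subSS -addnA leq_add2l.
  - by rewrite /= addSn ltnS subSS.
  case: H1 => a [b d]; split; first by rewrite /= ?o12 ?a.
  by rewrite /= b d Ey.
have Dcase : subseq x' (pmap id (unzip1 P)) ->
  exists P', [/\ is_edit_path P' x' y,
   (wgt P' <= (Some c != o2) + wgt P + (size (c :: pmap id (unzip1 P)) - size x'))%N &
    (size P < size P' + (size (c :: pmap id (unzip1 P)) - size x'))%N].
  move=> sx1; have [P' [H1 H2 H3]] := IH _ _ _ sx1 (conj pr (conj erefl erefl)).
  have le := size_subseq sx1.
  clear Kcase; case: o2 o12 Ey => [e|] _ Ey; last first.
    by exists P'; split; [rewrite -Ey | rewrite /= | ]; rewrite /= ?subSn //; lia.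
  exists ((None, Some e) :: P'); split; last 2 first.
  - rewrite /wgt /= in H2 *; rewrite /= ?subSn //; lia.
  - by rewrite /= ?subSn //; lia.
  by case: H1 => a [b d]; split => //=; rewrite b d -Ey.
case: x' sx Kcase Dcase => [|c' x'] /= sx Kcase Dcase; first exact: Dcase (sub0seq _).
case: eqP sx Kcase => [-> sx Kcase|_ sx _]; [exact: (Kcase x')|exact: Dcase].
Qed.

(** A letter missing from [x'] is put back as a deletion; [edit_path_split] cuts the path after each
    letter that is kept. *)
Lemma edit_path_supseq P x' x y : subseq x' x -> is_edit_path P x' y ->
  exists P', [/\ is_edit_path P' x y, (wgt P' <= wgt P + (size x - size x'))%N &
    (size P <= size P' + (size x - size x'))%N].
Proof.
elim: x x' P y => [|c x IH] x' P y.
  by rewrite subseq0 => /eqP -> H; exists P; split; rewrite ?leq_addr.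
move=> sx H; have [sx'|[x1 [Ex1 sx1]]] :
    subseq x' x \/ exists x1, x' = c :: x1 /\ subseq x1 x.
  case: x' sx {H} => [|c' x']; first by left; exact: sub0seq.
  by rewrite /=; case: eqP => [->|] ?; [right; exists x'|left].
  have [P' [H1 H2 H3]] := IH _ _ _ sx' H; have le := size_subseq sx'.
  exists ((Some c, None) :: P'); split; [|rewrite /wgt /= in H2 *; lia|rewrite /=; lia].
  by case: H1 => a [b d]; split => //=; rewrite b d.
have le := size_subseq sx1.
rewrite {}Ex1 in H *; rewrite -cat1s in H.
have [P1 [P2 [y1 [y2 [-> -> H1 H2]]]]] := edit_path_split H.
have [P' [H3 H4 H5]] := IH _ _ _ sx1 H2.
exists (P1 ++ P'); split; last 2 first.
- by rewrite !wgt_cat /=; lia.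
- by rewrite !size_cat /=; lia.
by rewrite -cat1s; exact: edit_path_cat.
Qed.

End Words.

(** * Walks as flows on the cyclic edit graphs *)

Section Traces.
Context (p q : nat) (p0 : (0 < p)%N) (q0 : (0 < q)%N).

(* The edge kinds in [edges] are ring literals of type [nat]. *)
Lemma edgesE : edges p q =
  [seq (0%N, l, k) | l <- iota 0 p, k <- iota 0 q.+1] ++
  [seq (1%N, l, k) | l <- iota 0 p.+1, k <- iota 0 q] ++
  [seq (2%N, l, k) | l <- iota 0 p, k <- iota 0 q].
Proof. by []. Qed.

Lemma mem_edges (t l k : nat) : ((t, l, k) \in edges p q) =
  [|| [&& t == 0, l < p & k < q.+1], [&& t == 1, l < p.+1 & k < q] |
      [&& t == 2, l < p & k < q]]%N.
Proof.
have H (t' a b : nat) : ((t, l, k) \in [seq (t', l, k) | l <- iota 0 a, k <- iota 0 b]) =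
    [&& t == t', l < a & k < b]%N.
  apply/allpairsP/and3P => [[[l' k'] [h1 h2 [-> -> ->]]]|[/eqP -> la kb]].
    by move: h1 h2; rewrite !mem_iota !add0n; split.
  by exists (l, k); split; rewrite ?mem_iota ?add0n.
by rewrite edgesE 2!mem_cat !H.
Qed.

Lemma uniq_edges : uniq (edges p q).
Proof.
have U (t a b : nat) : uniq [seq (t, l, k) | l <- iota 0 a, k <- iota 0 b].
  by apply: allpairs_uniq; rewrite ?iota_uniq // => -[? ?] [? ?] _ _ [-> ->].
have D (t t' a b a' b' : nat) : t != t' ->
    ~~ has (mem [seq (t, l, k) | l <- iota 0 a, k <- iota 0 b])
          [seq (t', l, k) | l <- iota 0 a', k <- iota 0 b'].
  move=> tt'; apply/hasPn => e /allpairsP[[l k] [_ _ ->]] /=.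
  by apply/negP => /allpairsP[[l' k'] [_ _ [E _ _]]]; rewrite E eqxx in tt'.
by rewrite edgesE 2!cat_uniq !U has_cat negb_or !D.
Qed.

Lemma etr_sub ts L K : proper ts -> {subset etr p q ts L K <= edges p q}.
Proof.
elim: ts L K => // m ts IH L K /= /andP[m0 pr] e.
rewrite inE => /predU1P[->|]; last exact: IH.
rewrite mem_edges; have := ltn_pmod L p0; have := ltn_pmod K q0.
by case: m m0 => [] [] [] //= _; lia.
Qed.

Lemma size_etr ts L K : size (etr p q ts L K) = size ts.
Proof. by elim: ts L K => //= m ts IH L K; rewrite IH. Qed.

Lemma etr_ind_x ts L K : proper ts -> (\sum_(e <- etr p q ts L K) ind_x e = cx ts)%N.
Proof.
elim: ts L K => [|m ts IH] L K /=; first by rewrite big_nil.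
by case/andP => m0 pr; rewrite big_cons IH //; case: m m0 => [] [] [].
Qed.

Lemma etr_ind_y ts L K : proper ts -> (\sum_(e <- etr p q ts L K) ind_y e = cy ts)%N.
Proof.
elim: ts L K => [|m ts IH] L K /=; first by rewrite big_nil.
by case/andP => m0 pr; rewrite big_cons IH //; case: m m0 => [] [] [].
Qed.

(* Telescoping: sources and targets along a walk agree except at its two ends. *)
Lemma etr_src_tgt w ts L K : proper ts ->
  (count (fun e => esrc p q e == w) (etr p q ts L K) +
    ((((L + cx ts) %% p, (K + cy ts) %% q) == w) : nat) =
   count (fun e => etgt p q e == w) (etr p q ts L K) +
    (((L %% p, K %% q) == w) : nat))%N.
Proof.
elim: ts L K => [|m ts IH] L K /=; first by rewrite /cx /cy /= !addn0.
case/andP => m0 pr; have := IH (L + m.1)%N (K + m.2)%N pr.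
rewrite /= !modn_mod -!addnA => E.
have -> : (if mtype m == 0 then ((L %% p).+1 %% p, K %% q)
   else if mtype m == 1 then (L %% p, (K %% q).+1 %% q)
   else ((L %% p).+1 %% p, (K %% q).+1 %% q))%N =
   ((L + m.1) %% p, (K + m.2) %% q)%N.
  have S a d : ((a %% d).+1 %% d = a.+1 %% d)%N.
    by rewrite -[(a %% d).+1]addn1 modnDml addn1.
  by case: m m0 {E} => [] [] [] //= _; rewrite ?S ?addn0 ?addn1.
by rewrite {1}addnCA; rewrite /cx /cy /= in E *; lia.
Qed.

Lemma etr_conserve w ts L K : proper ts -> (p %| cx ts)%N -> (q %| cy ts)%N ->
  count (fun e => esrc p q e == w) (etr p q ts L K) =
  count (fun e => etgt p q e == w) (etr p q ts L K).
Proof.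
move=> pr px qy; have := etr_src_tgt w L K pr.
have mD d a b : (d %| b)%N -> ((a + b) %% d = a %% d)%N.
  by case/dvdnP => k ->; rewrite addnC modnMDl.
by rewrite !mD //; lia.
Qed.

End Traces.

Lemma etr_cost (Sigma : eqType) (x y : seq Sigma) ts L K :
  x != [::] -> y != [::] -> proper ts ->
  (\sum_(e <- etr (size x) (size y) ts L K) ecost x y e = wgt (lab x y ts L K))%N.
Proof.
move=> x0 y0; elim: ts L K => [|m ts IH] L K /=; first by rewrite big_nil.
case/andP => m0 pr; rewrite big_cons IH //.
have := onth_mod L x0; have := onth_mod K y0.
rewrite /wgt /= -/(wgt _).
case: m m0 => [] [] [] //= _; do [case: onth => [b|] //=]; case: onth => [c|] //=.
by move=> _ _; rewrite -[Some c == Some b]/(c == b); case: (c == b).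
Qed.

Lemma wgt_lab_del (Sigma : eqType) (x y : seq Sigma) a L K : x != [::] ->
  wgt (lab x y (nseq a (true, false)) L K) = a.
Proof.
move=> x0; elim: a L K => //= a IH L K; rewrite /wgt /= -/(wgt _) IH.
by have := onth_mod L x0; case: onth.
Qed.

Lemma wgt_lab_ins (Sigma : eqType) (x y : seq Sigma) a L K : y != [::] ->
  wgt (lab x y (nseq a (false, true)) L K) = a.
Proof.
move=> x0; elim: a L K => //= a IH L K; rewrite /wgt /= -/(wgt _) IH.
by have := onth_mod K x0; case: onth.
Qed.

(** The flow of a walk is the multiplicity of each edge. This turns a linear functional of the flow
    back into a sum along the walk, which is how every constraint is evaluated. *)
Lemma big_count (R : realType) (E : eqType) (es s : seq E) (F : E -> R)
    (P : pred E) : uniq es -> {subset s <= es} ->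
  \sum_(e <- es | P e) (count_mem e s)%:R * F e = \sum_(e <- s | P e) F e.
Proof.
move=> ue; elim: s => [|e0 s IH] sub.
  by rewrite big_nil big1 // => e _; rewrite mul0r.
rewrite big_cons -IH => [|e es']; last by apply: sub; rewrite inE es' orbT.
under eq_bigr => e _ do rewrite /= natrD mulrDl.
rewrite big_split /=.
have -> : \sum_(e <- es | P e) (e0 == e)%:R * F e = if P e0 then F e0 else 0.
  rewrite (bigID (pred1 e0)) /= [X in _ + X]big1 ?addr0; last first.
    by move=> e /andP[_ ne]; rewrite eq_sym (negbTE ne) mul0r.
  have e0s : e0 \in es by apply: sub; rewrite inE eqxx.
  rewrite -big_filter; case: ifPn => Pe0.
    have -> : [seq e <- es | P e && (e == e0)] = [:: e0].
      rewrite -(filter_pred1_uniq ue e0s); apply: eq_filter => e /=.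
      by case: eqVneq => [->|]; rewrite ?Pe0 ?andbF.
    by rewrite big_seq1 eqxx mul1r.
  rewrite big_filter big_pred0 // => e.
  by case: eqVneq => [->|]; rewrite ?(negbTE Pe0) ?andbF.
by case: ifP => _; rewrite ?add0r.
Qed.

(** * Rows and columns met by an interleaving *)

Section Interleavings.
Context (n m : nat).

(** A discrete intermediate value argument: [key] grows by at most one per step, so no value is
    skipped. Every row and column thus has a cell in which padding can be placed. *)
Lemma step_hit (T : eqType) (key : T -> nat) (e : rel T) c s i :
  (forall c d, e c d -> (key d <= (key c).+1)%N) -> path e c s ->
  (key c <= i <= key (last c s))%N -> exists2 d, d \in c :: s & key d = i.
Proof.
move=> He; elim: s c => [|c' s IH] c /=.
  by move=> _ /andP[a b]; exists c; rewrite ?inE // ; lia.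
case/andP => cc' pth /andP[ci il].
have [ei|ne] := eqVneq (key c) i; first by exists c; rewrite ?inE ?eqxx.
have lt := He _ _ cc'.
have [|d ds <-] := IH c' pth; first by lia.
by exists d => //; rewrite inE ds orbT.
Qed.

Lemma istep_key1 (c d : 'I_n * 'I_m) : istep c d -> (d.1 <= c.1.+1)%N.
Proof. by case/orP => /andP[/eqP a /eqP b]; rewrite ?a // -?a ?b; lia. Qed.

Lemma istep_key2 (c d : 'I_n * 'I_m) : istep c d -> (d.2 <= c.2.+1)%N.
Proof. by case/orP => /andP[/eqP a /eqP b]; rewrite ?b // -?b ?a; lia. Qed.

Lemma interleaving_row pi (i : 'I_n) : is_interleaving (m:=m) pi ->
  exists2 c, c \in pi & c.1 = i.
Proof.
case=> c0 [s [[a b] pth l1 l2 ->]].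
have [|d ds di] := step_hit (i := i) (key := fun d => val d.1) istep_key1 pth.
  by rewrite a l1; have := ltn_ord i; lia.
by exists d; [rewrite inE|exact: val_inj].
Qed.

Lemma interleaving_col pi (j : 'I_m) : is_interleaving (n:=n) pi ->
  exists2 c, c \in pi & c.2 = j.
Proof.
case=> c0 [s [[a b] pth l1 l2 ->]].
have [|d ds di] := step_hit (i := j) (key := fun d => val d.2) istep_key2 pth.
  by rewrite b l2; have := ltn_ord j; lia.
by exists d; [rewrite inE|exact: val_inj].
Qed.

End Interleavings.

(* weight, cell, moves, and the starting position in the two words *)
Definition walk (R : realType) (n m : nat) : Type :=
  (R * ('I_n * 'I_m) * seq move * nat * nat)%type.

(** * Flows of weighted closed walks *)

Section WalkFlows.
Context (R : realType) (Sigma : eqType) (n m : nat)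
  (xs : 'I_n -> seq Sigma) (ys : 'I_m -> seq Sigma).
Hypothesis xs0 : forall i, xs i != [::].
Hypothesis ys0 : forall j, ys j != [::].

Definition wamt (z : walk R n m) : R := z.1.1.1.1.
Definition wcell (z : walk R n m) : 'I_n * 'I_m := z.1.1.1.2.
Definition wmoves (z : walk R n m) : seq move := z.1.1.2.
Definition wL (z : walk R n m) : nat := z.1.2.
Definition wK (z : walk R n m) : nat := z.2.

Implicit Types (z : walk R n m) (Z : seq (walk R n m)) (pi : {set 'I_n * 'I_m}).

Definition sx (i : 'I_n) := size (xs i).
Definition sy (j : 'I_m) := size (ys j).

Definition wok pi z : Prop :=
  [/\ wcell z \in pi, 0 <= wamt z, proper (wmoves z),
      (sx (wcell z).1 %| cx (wmoves z))%N & (sy (wcell z).2 %| cy (wmoves z))%N].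

Definition wtr z := etr (sx (wcell z).1) (sy (wcell z).2) (wmoves z) (wL z) (wK z).

Definition wcost z : nat :=
  wgt (lab (xs (wcell z).1) (ys (wcell z).2) (wmoves z) (wL z) (wK z)).

Definition wflow Z (c : 'I_n * 'I_m) (e : edge) : R :=
  \sum_(z <- Z | wcell z == c) wamt z * (count_mem e (wtr z))%:R.

Lemma sx_gt0 i : (0 < sx i)%N.
Proof. by rewrite /sx; case: (xs i) (xs0 i). Qed.

Lemma sy_gt0 j : (0 < sy j)%N.
Proof. by rewrite /sy; case: (ys j) (ys0 j). Qed.

Lemma wflow_cell pi Z c (P : pred edge) (F : edge -> R) :
  {in Z, forall z, wok pi z} ->
  \sum_(e <- edges (sx c.1) (sy c.2) | P e) wflow Z c e * F e =
  \sum_(z <- Z | wcell z == c) wamt z * \sum_(e <- wtr z | P e) F e.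
Proof.
elim: Z => [_|z Z IH H].
  by rewrite big_nil big1 // => e _; rewrite /wflow big_nil mul0r.
rewrite big_cons -IH => [|z' h]; last by apply: H; rewrite inE h orbT.
have [_ _ pr _ _] := H z (mem_head _ _).
case: eqP => zc; last first.
  by apply: eq_bigr => e _; rewrite /wflow big_cons; case: eqP.
rewrite -(@big_count _ _ (edges (sx c.1) (sy c.2)) (wtr z)); first last.
- by rewrite /wtr zc; apply: etr_sub => //; rewrite ?sx_gt0 ?sy_gt0.
- exact: uniq_edges.
rewrite big_distrr -big_split /=; apply: eq_bigr => e _.
by rewrite /wflow big_cons zc eqxx mulrDl mulrA.
Qed.

Lemma wflow_sum pi Z (P : pred ('I_n * 'I_m)) (F : 'I_n * 'I_m -> edge -> R) :
  {in Z, forall z, wok pi z} ->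
  \sum_(c in pi | P c) \sum_(e <- edges (sx c.1) (sy c.2)) wflow Z c e * F c e =
  \sum_(z <- Z | P (wcell z)) wamt z * \sum_(e <- wtr z) F (wcell z) e.
Proof.
move=> H.
under eq_bigr => c _ do rewrite (wflow_cell c xpredT (F c) H).
elim: Z H => [_|z Z IH H].
  by rewrite big_nil big1 // => c _; rewrite big_nil.
rewrite big_cons -IH => [|z' h]; last by apply: H; rewrite inE h orbT.
have [zpi _ _ _ _] := H z (mem_head _ _).
have -> : \sum_(c in pi | P c) \sum_(z0 <- (z :: Z) | wcell z0 == c)
    wamt z0 * (\sum_(e <- wtr z0) F c e) =
  \sum_(c in pi | P c) ((if wcell z == c then wamt z * (\sum_(e <- wtr z) F c e)
    else 0) + \sum_(z0 <- Z | wcell z0 == c) wamt z0 * (\sum_(e <- wtr z0) F c e)).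
  by apply: eq_bigr => c _; rewrite big_cons; case: ifP; rewrite ?add0r.
rewrite big_split /= -big_mkcondr /=.
have [Pz|Pz] := boolP (P (wcell z)).
  rewrite (big_pred1 (wcell z)) // => c /=; rewrite eq_sym.
  by case: eqVneq => [->|]; rewrite ?zpi ?Pz ?andbF.
rewrite big_pred0 ?add0r // => c; case: eqVneq => [<-|]; rewrite ?andbF //.
by rewrite (negbTE Pz) andbF.
Qed.

End WalkFlows.

Lemma inf_ge0 (R : realType) (E : set R) : (forall x, E x -> 0 <= x) -> 0 <= inf E.
Proof.
move=> H; have [->|/set0P[x Ex]] := eqVneq E set0; first by rewrite inf0.
by apply: lb_le_inf => //; exists x.
Qed.

(** * Feasible points of the linear program from closed walks *)

Section WalkLP.
Context (R : realType) (Sigma : eqType) (n m r : nat)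
  (xs : 'I_n -> seq Sigma) (ys : 'I_m -> seq Sigma) (v : 'I_r -> 'I_m -> nat).
Hypothesis xs0 : forall i, xs i != [::].
Hypothesis ys0 : forall j, ys j != [::].
Implicit Types (z : walk R n m) (Z : seq (walk R n m)) (pi : {set 'I_n * 'I_m}).

Definition Wsum Z : R := \sum_(z <- Z) wamt z * (wcost xs ys z)%:R.
Definition Ssum Z : R := \sum_(z <- Z) wamt z * (size (wmoves z))%:R.
Definition rowsum Z (i : 'I_n) : R :=
  \sum_(z <- Z | (wcell z).1 == i) wamt z * (cx (wmoves z))%:R.
Definition colsum Z (j : 'I_m) : R :=
  \sum_(z <- Z | (wcell z).2 == j) wamt z * (cy (wmoves z))%:R.

Lemma wtr_size z : \sum_(e <- wtr xs ys z) (1 : R) = (size (wmoves z))%:R.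
Proof. by rewrite big_const_seq count_predT size_etr iter_addr addr0. Qed.

Lemma wtr_ind_x pi z : wok xs ys pi z ->
  \sum_(e <- wtr xs ys z) (ind_x e)%:R = (cx (wmoves z))%:R :> R.
Proof. by case=> _ _ pr _ _; rewrite -natr_sum etr_ind_x. Qed.

Lemma wtr_ind_y pi z : wok xs ys pi z ->
  \sum_(e <- wtr xs ys z) (ind_y e)%:R = (cy (wmoves z))%:R :> R.
Proof. by case=> _ _ pr _ _; rewrite -natr_sum etr_ind_y. Qed.

Lemma wtr_cost pi z : wok xs ys pi z ->
  \sum_(e <- wtr xs ys z) (ecost (xs (wcell z).1) (ys (wcell z).2) e)%:R =
  (wcost xs ys z)%:R :> R.
Proof. by case=> _ _ pr _ _; rewrite -natr_sum etr_cost. Qed.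

Lemma Ssum_row Z : \sum_(i < n) rowsum Z i = \sum_(z <- Z) wamt z * (cx (wmoves z))%:R.
Proof.
rewrite /rowsum (exchange_big_dep predT) //=; apply: eq_bigr => z _.
by rewrite (big_pred1 (wcell z).1) // => i /=; rewrite eq_sym.
Qed.

(** Closed walks are conserved at every vertex, so once the flow is divided by the total length [T]
    only the prescribed contents remain to be checked. The scale [N] reappears as [lam = N / T]. *)
Lemma LP_of_walks pi Z (a : 'rV[R^o]_n) (t : 'I_r -> R) (N : R) :
  {in Z, forall z, wok xs ys pi z} -> 0 < N ->
  \sum_i (sx xs i)%:R * a ord0 i = 1 ->
  (forall i, rowsum Z i = (sx xs i)%:R * a ord0 i * N) ->
  (forall s, 0 <= t s) ->
  (forall j, colsum Z j = (sy ys j)%:R * \sum_(s < r) t s * (v s j)%:R) ->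
  let T := Ssum Z in
  [/\ 0 < T, LP_feasible xs ys v a pi (fun c e => wflow xs ys Z c e / T)
     (fun s => t s / T) (N / T) &
   LP_obj xs ys (fun c e => wflow xs ys Z c e / T) pi = Wsum Z / T].
Proof.
move=> Zok N0 a1 rowE t0 colE T.
(* This becomes [lam <= 1]: a step reads at most one letter of the first word, so the row contents,
   whose sum is [N], cannot exceed the length. *)
have NT : N <= T.
  have -> : N = \sum_i rowsum Z i.
    by under eq_bigr => i _ do rewrite rowE; rewrite -mulr_suml a1 mul1r.
  rewrite Ssum_row /T /Ssum !big_seq ler_sum // => z /Zok [_ w0 _ _ _].
  by rewrite ler_wpM2l // ler_nat count_size.
have T0 : 0 < T by apply: lt_le_trans NT.
have sumT (P : pred ('I_n * 'I_m)) (F : 'I_n * 'I_m -> edge -> R) :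
    \sum_(c in pi | P c) \sum_(e <- edges (sx xs c.1) (sy ys c.2))
       wflow xs ys Z c e / T * F c e =
    (\sum_(z <- Z | P (wcell z)) wamt z * \sum_(e <- wtr xs ys z) F (wcell z) e) / T.
  rewrite -(wflow_sum xs0 ys0 (pi := pi)) // mulr_suml; apply: eq_bigr => c _.
  by rewrite mulr_suml; apply: eq_bigr => e _; rewrite mulrAC.
have sumT' (F : 'I_n * 'I_m -> edge -> R) :
    \sum_(c in pi) \sum_(e <- edges (sx xs c.1) (sy ys c.2))
       wflow xs ys Z c e / T * F c e =
    (\sum_(z <- Z) wamt z * \sum_(e <- wtr xs ys z) F (wcell z) e) / T.
  by rewrite -(sumT predT F); apply: eq_bigl => c; rewrite andbT.
split => //; last first.
  rewrite /LP_obj /= sumT' /Wsum; congr (_ / _).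
  rewrite big_seq [RHS]big_seq; apply: eq_bigr => z /Zok zok.
  by rewrite (wtr_cost zok).
split.
- split => [c e|s|]; last by rewrite divr_gt0 //= ler_pdivrMr // mul1r.
    apply: divr_ge0; last exact: ltW.
    rewrite /wflow big_seq_cond; apply: sumr_ge0 => z /andP[/Zok zok _].
    by case: zok => _ ? _ _ _; rewrite mulr_ge0.
  by rewrite divr_ge0 // ltW.
- transitivity ((\sum_(z <- Z) wamt z * (\sum_(e <- wtr xs ys z) (1 : R))) / T).
    rewrite -(sumT' (fun _ _ => 1)) /=.
    by apply: eq_bigr => c _; apply: eq_bigr => e _; rewrite mulr1.
  under eq_bigr => z _ do rewrite wtr_size.
  by rewrite divff // gt_eqF.
- move=> c cpi w _ /=.
  have P (g : edge -> nat * nat) :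
     \sum_(e <- edges (sx xs c.1) (sy ys c.2) | g e == w) wflow xs ys Z c e / T =
     (\sum_(z <- Z | wcell z == c) wamt z *
         (count (fun e => g e == w) (wtr xs ys z))%:R) / T.
    rewrite -mulr_suml; congr (_ / _).
    under eq_bigr => e _ do rewrite -[wflow _ _ _ _ _]mulr1.
    rewrite (wflow_cell xs0 ys0 (pi := pi) _ _ _) //; apply: eq_bigr => z _.
    by rewrite big_const_seq iter_addr addr0.
  rewrite !P; congr (_ / _); rewrite big_seq_cond [RHS]big_seq_cond.
  apply: eq_bigr => z /andP[/Zok [_ _ pr dx dy] /eqP zc]; congr (_ * _%:R).
  rewrite /wtr zc in dx dy *; apply: etr_conserve => //.
- by exact: sx_gt0.
- by exact: sy_gt0.
- move=> i /=; rewrite sumT mulrA -rowE; congr (_ / _).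
  rewrite /rowsum big_seq_cond [RHS]big_seq_cond; apply: eq_bigr => z /andP[/Zok zok _].
  by rewrite (wtr_ind_x zok).
- move=> j /=; rewrite sumT.
  have -> : (size (ys j))%:R * (\sum_(s < r) t s / T * (v s j)%:R) = colsum Z j / T.
    rewrite colE -mulrA; congr (_ * _); rewrite mulr_suml; apply: eq_bigr => s _.
    by rewrite mulrAC.
  congr (_ / _).
  rewrite /colsum big_seq_cond [RHS]big_seq_cond; apply: eq_bigr => z /andP[/Zok zok _].
  by rewrite (wtr_ind_y zok).
Qed.

(* Missing row and column contents are filled up by real multiples of laps of
   deletions and insertions, each of which costs its own length. *)
Lemma LP_of_padded_walks pi Z (a : 'rV[R^o]_n) (t : 'I_r -> R) (N : R) :
  is_interleaving pi -> {in Z, forall z, wok xs ys pi z} -> 0 < N ->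
  \sum_i (sx xs i)%:R * a ord0 i = 1 ->
  (forall i, rowsum Z i <= (sx xs i)%:R * a ord0 i * N) ->
  (forall s, 0 <= t s) ->
  (forall j, colsum Z j <= (sy ys j)%:R * \sum_(s < r) t s * (v s j)%:R) ->
  let g : R := \sum_i ((sx xs i)%:R * a ord0 i * N - rowsum Z i) +
           \sum_j ((sy ys j)%:R * (\sum_(s < r) t s * (v s j)%:R) - colsum Z j) in
  0 < Ssum Z + g /\
  exists f tau lam, LP_feasible xs ys v a pi f tau lam /\
    LP_obj xs ys f pi = (Wsum Z + g) / (Ssum Z + g).
Proof.
move=> piI Zok N0 a1 rowL t0 colL g.
have /choice [rc rcP] : forall i, exists c, c \in pi /\ c.1 = i.
  by move=> i; have [c] := interleaving_row i piI; exists c.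
have /choice [cc ccP] : forall j, exists c, c \in pi /\ c.2 = j.
  by move=> j; have [c] := interleaving_col j piI; exists c.
pose gx i : R := (sx xs i)%:R * a ord0 i * N - rowsum Z i.
pose gy j : R := (sy ys j)%:R * (\sum_(s < r) t s * (v s j)%:R) - colsum Z j.
pose zx i : walk R n m := (gx i / (sx xs i)%:R, rc i, nseq (sx xs i) (true, false), 0%N, 0%N).
pose zy j : walk R n m := (gy j / (sy ys j)%:R, cc j, nseq (sy ys j) (false, true), 0%N, 0%N).
pose Z' := Z ++ [seq zx i | i <- enum 'I_n] ++ [seq zy j | j <- enum 'I_m].
have sx0 i : (sx xs i)%:R != 0 :> R by rewrite pnatr_eq0 -lt0n sx_gt0.
have sy0 j : (sy ys j)%:R != 0 :> R by rewrite pnatr_eq0 -lt0n sy_gt0.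
have cxx k : cx (nseq k (true, false)) = k by rewrite /cx count_nseq mul1n.
have cyx k : cy (nseq k (true, false)) = 0%N by rewrite /cy count_nseq mul0n.
have cxy k : cx (nseq k (false, true)) = 0%N by rewrite /cx count_nseq mul0n.
have cyy k : cy (nseq k (false, true)) = k by rewrite /cy count_nseq mul1n.
have Zok' : {in Z', forall z, wok xs ys pi z}.
  move=> z; rewrite !mem_cat => /or3P[/Zok //|/mapP[i _ ->]|/mapP[j _ ->]].
    have [h1 h2] := rcP i.
    split; rewrite /wcell /wamt /wmoves /= ?cxx ?cyx ?h1 ?h2 ?dvdn0 //.
      by rewrite divr_ge0 // subr_ge0.
    by rewrite /proper all_nseq orbT.
  have [h1 h2] := ccP j.
  split; rewrite /wcell /wamt /wmoves /= ?cxy ?cyy ?h1 ?h2 ?dvdn0 //.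
    by rewrite divr_ge0 // subr_ge0.
  by rewrite /proper all_nseq orbT.
have sumZ (P : pred ('I_n * 'I_m)) (F : walk R n m -> R) :
  \sum_(z <- Z' | P (wcell z)) F z = \sum_(z <- Z | P (wcell z)) F z +
    (\sum_(i | P (rc i)) F (zx i) + \sum_(j | P (cc j)) F (zy j)).
  by rewrite /Z' 2!big_cat /= 2!big_map 2!big_enum_cond.
have sumZ' (F : walk R n m -> R) :
  \sum_(z <- Z') F z = \sum_(z <- Z) F z + (\sum_i F (zx i) + \sum_j F (zy j)).
  exact: (sumZ predT).
have gxE i : gx i / (sx xs i)%:R * (sx xs i)%:R = gx i by rewrite divfK.
have gyE j : gy j / (sy ys j)%:R * (sy ys j)%:R = gy j by rewrite divfK.
have row' i : rowsum Z' i = (sx xs i)%:R * a ord0 i * N.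
  rewrite /rowsum (sumZ (fun c => c.1 == i)) -/(rowsum Z i).
  rewrite (big_pred1 i) => [|i' /=]; last by have [_ ->] := rcP i'.
  rewrite big1 ?addr0 => [|j _]; last by rewrite /wmoves /= cxy mulr0.
  by rewrite /wamt /wmoves /= cxx gxE /gx addrC subrK.
have col' j : colsum Z' j = (sy ys j)%:R * (\sum_(s < r) t s * (v s j)%:R).
  rewrite /colsum (sumZ (fun c => c.2 == j)) -/(colsum Z j).
  rewrite [X in _ + (_ + X)](big_pred1 j) => [|j' /=]; last by have [_ ->] := ccP j'.
  rewrite big1 ?add0r => [|i _]; last by rewrite /wmoves /= cyx mulr0.
  by rewrite /wamt /wmoves /= cyy gyE /gy addrC subrK.
have SE : Ssum Z' = Ssum Z + g.
  rewrite /Ssum sumZ'; congr (_ + (_ + _)); apply: eq_bigr => k _;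
  by rewrite /wamt /wmoves /= size_nseq ?gxE ?gyE.
have WE : Wsum Z' = Wsum Z + g.
  rewrite /Wsum sumZ'; congr (_ + (_ + _)); apply: eq_bigr => k _;
  rewrite /wamt /wcost /wcell /wmoves /=.
    by rewrite wgt_lab_del ?gxE.
  by rewrite wgt_lab_ins ?gyE.
have [] := LP_of_walks Zok' N0 a1 row' t0 col'.
rewrite SE WE => S0 feas obj; split => //; do 3 eexists; split; [exact: feas|exact: obj].
Qed.

(** Padding the empty family of walks: the prescribed rows are deleted outright and [tau] is 0. With
    an empty feasible set the infimum [OPT] would be the default 0. *)
Lemma LP_feasible_ex pi (a : 'rV[R^o]_n) : is_interleaving pi ->
  (forall i, 0 <= a ord0 i) -> \sum_i (sx xs i)%:R * a ord0 i = 1 ->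
  exists f tau lam, LP_feasible xs ys v a pi f tau lam.
Proof.
move=> piI a0 a1.
have Zok : {in [::], forall z : walk R n m, wok xs ys pi z} by [].
have rowL i : rowsum [::] i <= (sx xs i)%:R * a ord0 i * 1.
  by rewrite /rowsum big_nil mulr1 mulr_ge0.
have t0 (s : 'I_r) : 0 <= (fun=> 0) s :> R by [].
have colL j : colsum [::] j <= (sy ys j)%:R * (\sum_(s < r) (fun=> 0) s * (v s j)%:R).
  rewrite /colsum big_nil; apply: mulr_ge0 => //; apply: sumr_ge0 => s _.
  by rewrite mul0r.
have [_ [f [tau [lam [h _]]]]] := LP_of_padded_walks piI Zok ltr01 a1 rowL t0 colL.
by exists f, tau, lam.
Qed.

Lemma LP_obj_bounds (a : 'rV[R^o]_n) pi f tau lam :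
  LP_feasible xs ys v a pi f tau lam -> 0 <= LP_obj xs ys f pi <= 1.
Proof.
case=> -[f0 _ _] f1 _ _ _; apply/andP; split.
  by do 2!(apply: sumr_ge0 => ? _); rewrite mulr_ge0.
rewrite -f1; apply: ler_sum => c _; apply: ler_sum => -[[t l] k] _.
rewrite ler_piMr // -[X in _ <= X]/(1%:R) ler_nat /ecost.
by case: ifP => // _; do 2!case: onth => [?|] //; case: ifP.
Qed.

Lemma OPT_le (a : 'rV[R^o]_n) pi f tau lam :
  LP_feasible xs ys v a pi f tau lam -> OPT xs ys v a pi <= LP_obj xs ys f pi.
Proof.
move=> feas; apply: ge_inf; last by exists f => //; exists tau, lam.
by exists 0 => _ [f' [tau' [lam' /LP_obj_bounds /andP[? _]]] <-].
Qed.

Lemma OPT_ge0 (a : 'rV[R^o]_n) pi : 0 <= OPT xs ys v a pi.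
Proof.
apply: inf_ge0 => _ [f' [tau [lam /LP_obj_bounds /andP[? _]]] <-] //.
Qed.

End WalkLP.

(** * Cutting an edit path along the blocks *)

Section Splitting.
Context (Sigma : eqType).
Implicit Types (u w : seq Sigma) (P : seq (edit_op Sigma)).

Lemma cat_eq_split u1 u2 w1 w2 : u1 ++ u2 = w1 ++ w2 -> (size u1 <= size w1)%N ->
  exists z, w1 = u1 ++ z /\ u2 = z ++ w2.
Proof.
move=> E le; exists (drop (size u1) w1).
have E1 : u1 = take (size u1) w1.
  by have := congr1 (take (size u1)) E; rewrite take_size_cat // takel_cat.
split; first by rewrite [X in X ++ _]E1 cat_take_drop.
have := congr1 (drop (size u1)) E; rewrite drop_size_cat // => ->.
by rewrite drop_cat; case: ltngtP le => // -> _; rewrite subnn drop0 drop_size.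
Qed.

(** The block exhausted first ends the current cell; what is left of the other block is carried into
    the next one. *)
Lemma edit_path_split2 P u1 u2 w1 w2 : is_edit_path P (u1 ++ u2) (w1 ++ w2) ->
  (exists P1 P2 wa wb, [/\ P = P1 ++ P2, w1 = wa ++ wb, is_edit_path P1 u1 wa &
     is_edit_path P2 u2 (wb ++ w2)]) \/
  (exists P1 P2 ua ub, [/\ P = P1 ++ P2, u1 = ua ++ ub, is_edit_path P1 ua w1 &
     is_edit_path P2 (ub ++ u2) w2]).
Proof.
move=> H; have [P1 [P2 [y1 [y2 [EP Ey H1 H2]]]]] := edit_path_split H.
have [le|lt] := leqP (size y1) (size w1).
  have [z [-> Ey2]] := cat_eq_split (esym Ey) le.
  by left; exists P1, P2, y1, z; split => //; rewrite -Ey2.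
have [z [Ey1 ->]] := cat_eq_split Ey (ltnW lt).
rewrite Ey1 in H1; have [Q1 [Q2 [ua [ub [EP1 -> H3 H4]]]]] := edit_path_splitr H1.
right; exists Q1, (Q2 ++ P2), ua, ub; split => //; first by rewrite EP EP1 catA.
exact: edit_path_cat.
Qed.

End Splitting.

Section Blocks.
Context (Sigma : eqType) (n : nat) (xs : 'I_n -> seq Sigma) (nu : 'I_n -> nat).

Definition block (i : 'I_n) := flatten (nseq (nu i) (xs i)).
Definition tail (i : 'I_n) := flatten (drop i.+1 [seq block j | j <- enum 'I_n]).

Lemma drop_enum (i : 'I_n) : drop i (enum 'I_n) = i :: drop i.+1 (enum 'I_n).
Proof. by rewrite (drop_nth i) ?size_enum_ord // nth_ord_enum. Qed.

Lemma tail_last (i : 'I_n) : i.+1 = n -> tail i = [::].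
Proof. by move=> E; rewrite /tail drop_oversize // size_map size_enum_ord E. Qed.

Lemma tail_next (i j : 'I_n) : j = i.+1 :> nat -> tail i = block j ++ tail j.
Proof. by move=> E; rewrite /tail -E -map_drop drop_enum /= map_drop. Qed.

Lemma wordX_tail (i : 'I_n) : i = 0%N :> nat -> wordX xs nu = block i ++ tail i.
Proof.
move=> E; rewrite /wordX -[enum 'I_n]drop0 -{1}E drop_enum /=.
by rewrite /tail -map_drop.
Qed.

End Blocks.

Section Cells.
Context (R : realType) (Sigma : eqType) (n m : nat)
  (xs : 'I_n -> seq Sigma) (ys : 'I_m -> seq Sigma)
  (nu : 'I_n -> nat) (mu : 'I_m -> nat).
Hypothesis xs0 : forall i, xs i != [::].
Hypothesis ys0 : forall j, ys j != [::].
Implicit Types (z : walk R n m) (Z : seq (walk R n m)) (c : 'I_n * 'I_m).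

Lemma block_cyc (k : nat) (zs : 'I_k -> seq Sigma) (t : 'I_k -> nat) i :
  (forall j, zs j != [::]) -> block zs t i = cyc (zs i) 0 (t i * size (zs i)).
Proof. by move=> zs0; rewrite cyc_laps. Qed.

(** Letters still to be read in each block when [a] letters of block [i0] remain: earlier blocks are
    used up, later ones are untouched. *)
Definition cont (k : nat) (len : 'I_k -> nat) (i0 : 'I_k) (a : nat) (i : 'I_k) : nat :=
  if i == i0 then a else if (i0 < i)%N then len i else 0%N.

Lemma cont_next k len (i0 i1 i : 'I_k) a : i1 = i0.+1 :> nat ->
  cont len i0 a i = ((if i0 == i then a else 0) + cont len i1 (len i1) i)%N.
Proof.
rewrite /cont => E; rewrite eq_sym.
have [<-|ne] := eqVneq i1 i.
  by rewrite -val_eqE /= E ltnS leqnn eqn_leq ltnn andbF.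
have [<-|ne'] := eqVneq i0 i; first by rewrite E ltnNge leqnSn addn0.
rewrite E; rewrite -val_eqE /= E in ne.
by rewrite add0n [in RHS]ltn_neqAle ne.
Qed.

Lemma cont_split k len (i0 i : 'I_k) a b :
  cont len i0 (a + b) i = ((if i0 == i then a else 0) + cont len i0 b i)%N.
Proof. by rewrite /cont eq_sym; case: ifP => // /eqP ->; case: ifP. Qed.

Definition xlen i := (nu i * sx xs i)%N.
Definition ylen j := (mu j * sy ys j)%N.

(** The strict bound on [size Z] counts the cells from [c] to the last corner. It is what makes the
    closing error independent of the words. *)
Definition cells_spec c (a b : nat) (P : seq (edit_op Sigma)) Z : Prop :=
  [/\ (exists s, [/\ [seq wcell z | z <- Z] = c :: s, path (@istep n m) c s,
          val (last c s).1 = n.-1 & val (last c s).2 = m.-1]),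
      {in Z, forall z, wamt z = 1 /\ proper (wmoves z)},
      [/\ (\sum_(z <- Z) size (wmoves z) = size P)%N,
          (\sum_(z <- Z) wcost xs ys z = wgt P)%N & (size Z + c.1 + c.2 < n + m)%N],
      (forall i, (\sum_(z <- Z | (wcell z).1 == i) cx (wmoves z))%N = cont xlen c.1 a i) &
      (forall j, (\sum_(z <- Z | (wcell z).2 == j) cy (wmoves z))%N = cont ylen c.2 b j)].

Lemma cells_cons c c' L K a b a1 b1 a' b' P1 P2 Z :
  istep c c' -> is_edit_path P1 (cyc (xs c.1) L a1) (cyc (ys c.2) K b1) ->
  (forall i, cont xlen c.1 a i = (if c.1 == i then a1 else 0) + cont xlen c'.1 a' i)%N ->
  (forall j, cont ylen c.2 b j = (if c.2 == j then b1 else 0) + cont ylen c'.2 b' j)%N ->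
  cells_spec c' a' b' P2 Z ->
  cells_spec c a b (P1 ++ P2) ((1, c, moves P1, L, K) :: Z).
Proof.
move=> cc' H1 Ex Ey [[s [Zs pth l1 l2]] Zp [sz wg cnt] row col].
have [pr PE cxE cyE] := lab_moves (xs0 _) (ys0 _) H1.
split.
- by exists (c' :: s); split => //=; rewrite ?Zs ?cc'.
- by move=> z; rewrite inE => /predU1P[->|/Zp].
- split; rewrite ?big_cons /=.
  + by rewrite sz size_cat /moves /= size_map.
  + by rewrite wg wgt_cat /wcost /= -PE.
  + suff : (c'.1 + c'.2 = (c.1 + c.2).+1)%N by lia.
    case/orP: cc' => /andP[/eqP h1 /eqP h2].
      by rewrite h2 -[nat_of_ord c'.1]/(val c'.1) h1 addSn.
    by rewrite h1 -[nat_of_ord c'.2]/(val c'.2) h2 addnS.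
- move=> i; rewrite big_cons Ex row /= /wcell /wmoves /= cxE.
  by case: ifP.
- move=> j; rewrite big_cons Ey col /= /wcell /wmoves /= cyE.
  by case: ifP.
Qed.

(** The offsets [L] and [K] let the path start inside a block: when one block is exhausted, the
    other is in general only partly read. The induction is on the number of rows and columns
    left. *)
Lemma path_cells c L a K b P :
  is_edit_path P (cyc (xs c.1) L a ++ tail xs nu c.1)
                 (cyc (ys c.2) K b ++ tail ys mu c.2) ->
  exists Z, cells_spec c a b P Z.
Proof.
move: {2}(_ + _)%N (leqnn ((n - c.1) + (m - c.2))) => k.
elim: k c L a K b P => [|k IH] [i j] L a K b P /= le H.
  by have := ltn_ord i; lia.
have row_step (i' : 'I_n) P1 P2 wa wb : i' = i.+1 :> nat -> P = P1 ++ P2 ->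
    cyc (ys j) K b = wa ++ wb -> is_edit_path P1 (cyc (xs i) L a) wa ->
    is_edit_path P2 (tail xs nu i) (wb ++ tail ys mu j) ->
    exists Z, cells_spec (i, j) a b P Z.
  move=> Ei -> Ew H1; rewrite (tail_next _ _ Ei) block_cyc // => H2.
  have [Ea Eb bE] := cyc_split (ys0 _) Ew.
  rewrite Ea in H1; rewrite Eb in H2.
  have [|Z HZ] := IH (i', j) _ _ _ _ _ _ H2; first by rewrite /= Ei; have := ltn_ord i'; lia.
  exists ((1, (i, j), moves P1, L, K) :: Z).
  apply: cells_cons HZ => //=.
  - by rewrite /istep /= Ei !eqxx.
  - exact: H1.
  - by move=> i0; rewrite (cont_next _ _ _ Ei).
  - by move=> j0; rewrite bE cont_split.
have col_step (j' : 'I_m) P1 P2 ua ub : j' = j.+1 :> nat -> P = P1 ++ P2 ->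
    cyc (xs i) L a = ua ++ ub -> is_edit_path P1 ua (cyc (ys j) K b) ->
    is_edit_path P2 (ub ++ tail xs nu i) (tail ys mu j) ->
    exists Z, cells_spec (i, j) a b P Z.
  move=> Ej -> Eu H1; rewrite (tail_next _ _ Ej) block_cyc // => H2.
  have [Ea Eb aE] := cyc_split (xs0 _) Eu.
  rewrite Ea in H1; rewrite Eb in H2.
  have [|Z HZ] := IH (i, j') _ _ _ _ _ _ H2; first by rewrite /= Ej; have := ltn_ord j'; lia.
  exists ((1, (i, j), moves P1, L, K) :: Z).
  apply: cells_cons HZ => //=.
  - by rewrite /istep /= Ej !eqxx orbT.
  - exact: H1.
  - by move=> i0; rewrite aE cont_split.
  - by move=> j0; rewrite (cont_next _ _ _ Ej).
(* In the last row or the last column only one kind of step is possible and the corresponding tail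
   is empty; elsewhere the block exhausted first decides. *)
have [ilast|inl] := eqVneq i.+1 n; have [jlast|jnl] := eqVneq j.+1 m.
- rewrite (tail_last _ _ ilast) (tail_last _ _ jlast) !cats0 in H.
  have [pr PE cxE cyE] := lab_moves (xs0 _) (ys0 _) H.
  exists [:: (1, (i, j), moves P, L, K)]; split.
  + exists [::]; split => //=; [by rewrite -[in RHS]ilast|by rewrite -[in RHS]jlast].
  + by move=> z; rewrite inE => /eqP ->.
  + split; rewrite ?big_seq1 /=; last by lia.
      by rewrite /moves size_map.
    by rewrite /wcost /= -PE.
  + move=> i0; rewrite big_mkcond big_seq1 /wcell /wmoves /= cxE /cont eq_sym.
    by case: ifP => // _; case: ifP => //; have := ltn_ord i0; lia.
  + move=> j0; rewrite big_mkcond big_seq1 /wcell /wmoves /= cyE /cont eq_sym.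
    by case: ifP => // _; case: ifP => //; have := ltn_ord j0; lia.
- have jlt : (j.+1 < m)%N by have := ltn_ord j; lia.
  have [P1 [P2 [ua [ub [EP Eu H1 H2]]]]] := edit_path_splitr H.
  rewrite tail_last // cats0 in Eu.
  apply: (col_step (Ordinal jlt) P1 P2 ua ub) => //.
  by rewrite (tail_last _ _ ilast) cats0.
- have ilt : (i.+1 < n)%N by have := ltn_ord i; lia.
  have [P1 [P2 [wa [wb [EP Ew H1 H2]]]]] := edit_path_split H.
  rewrite tail_last // cats0 in Ew.
  apply: (row_step (Ordinal ilt) P1 P2 wa wb) => //.
  by rewrite (tail_last _ _ jlast) cats0.
have jlt : (j.+1 < m)%N by have := ltn_ord j; lia.
have ilt : (i.+1 < n)%N by have := ltn_ord i; lia.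
have [[P1 [P2 [wa [wb [EP Ew H1 H2]]]]]|[P1 [P2 [ua [ub [EP Eu H1 H2]]]]]] :=
  edit_path_split2 H.
- exact: (row_step (Ordinal ilt) P1 P2 wa wb).
- exact: (col_step (Ordinal jlt) P1 P2 ua ub).
Qed.

Lemma wordX_cells P : (0 < n)%N -> (0 < m)%N ->
  is_edit_path P (wordX xs nu) (wordX ys mu) ->
  exists pi Z, [/\ is_interleaving pi,
    {in Z, forall z, [/\ wcell z \in pi, wamt z = 1 & proper (wmoves z)]},
    [/\ (\sum_(z <- Z) size (wmoves z) = size P)%N,
        (\sum_(z <- Z) wcost xs ys z = wgt P)%N & (size Z <= n + m)%N],
    (forall i, (\sum_(z <- Z | (wcell z).1 == i) cx (wmoves z))%N = xlen i) &
    (forall j, (\sum_(z <- Z | (wcell z).2 == j) cy (wmoves z))%N = ylen j)].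
Proof.
move=> n0 m0; rewrite (@wordX_tail _ _ _ _ (Ordinal n0)) // (@wordX_tail _ _ _ _ (Ordinal m0)) //.
rewrite !block_cyc // => H.
have [Z [[s [Zs pth l1 l2]] Zp [sz wg cnt] row col]] :=
  @path_cells (Ordinal n0, Ordinal m0) _ _ _ _ _ H.
exists [set c | c \in (Ordinal n0, Ordinal m0) :: s]%SET, Z; split => //.
- by exists (Ordinal n0, Ordinal m0), s.
- move=> z zZ; have [h1 h2] := Zp z zZ; split => //.
  by rewrite inE -Zs map_f.
- by split => //; move: cnt => /=; lia.
- move=> i; rewrite row /cont /=; case: eqP => [->//|ne].
  by case: ifP => // /negbT; rewrite -leqNgt leqn0 => /eqP E; case: ne; exact: val_inj.
- move=> i; rewrite col /cont /=; case: eqP => [->//|ne].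
  by case: ifP => // /negbT; rewrite -leqNgt leqn0 => /eqP E; case: ne; exact: val_inj.
Qed.

End Cells.

Lemma ler_div2 (R : realType) (a b c d : R) : 0 <= a -> a <= b -> 0 < d -> d <= c ->
  a / c <= b / d.
Proof.
move=> a0 ab d0 dc; have c0 : 0 < c by apply: lt_le_trans dc.
by apply: ler_pM => //; [rewrite invr_ge0 ltW|rewrite lef_pV2].
Qed.

(** * From edit paths to linear programs *)

Section WordX.
Context (Sigma : eqType) (n : nat) (xs : 'I_n -> seq Sigma).

Lemma subseq_flatten (T : Type) (e : seq T) (f g : T -> seq Sigma) :
  (forall i, subseq (f i) (g i)) ->
  subseq (flatten [seq f i | i <- e]) (flatten [seq g i | i <- e]).
Proof. by move=> H; elim: e => //= i e IH; exact: cat_subseq. Qed.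

Lemma subseq_wordX nu nu' : (forall i, nu' i <= nu i)%N ->
  subseq (wordX xs nu') (wordX xs nu).
Proof.
move=> H; apply: subseq_flatten => i; rewrite -(subnKC (H i)) nseqD flatten_cat.
exact: prefix_subseq.
Qed.

Lemma size_wordX nu : size (wordX xs nu) = (\sum_i nu i * sx xs i)%N.
Proof.
rewrite /wordX size_flatten /shape -map_comp sumnE big_map big_enum /=.
apply: eq_bigr => i _; rewrite size_flatten /shape map_nseq sumnE big_nseq.
by rewrite iter_addn_0 mulnC.
Qed.

End WordX.

(** * Completing a walk to a closed walk *)

Section Closing.
Context (Sigma : eqType).

Lemma lab_cat (x y : seq Sigma) ts1 ts2 L K : lab x y (ts1 ++ ts2) L K =
  lab x y ts1 L K ++ lab x y ts2 (L + cx ts1) (K + cy ts1).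
Proof.
elim: ts1 L K => [|t ts IH] L K /=; first by rewrite /cx /cy /= !addn0.
by rewrite IH /cx /cy /= !addnA.
Qed.

(** Letters missing up to the next multiple of [p]. The outer reduction gives 0 rather than [p] at a
    multiple, so an empty walk is closed by nothing. *)
Definition gap (p a : nat) := ((p - a %% p) %% p)%N.

Lemma gap_dvd p a : (0 < p)%N -> (p %| a + gap p a)%N.
Proof.
move=> p0; rewrite /gap /dvdn modnDmr -modnDml subnKC ?modnn //.
by rewrite ltnW // ltn_mod.
Qed.

Lemma gap_le p a : (0 < p)%N -> (gap p a <= p)%N.
Proof. by move=> p0; rewrite ltnW // ltn_mod. Qed.

Lemma gap0 p : gap p 0 = 0%N.
Proof. by rewrite /gap mod0n subn0 modnn. Qed.

Definition close (p q : nat) (ts : seq move) : seq move :=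
  ts ++ nseq (gap p (cx ts)) (true, false) ++ nseq (gap q (cy ts)) (false, true).

Lemma cx_close p q ts : cx (close p q ts) = (cx ts + gap p (cx ts))%N.
Proof. by rewrite /close /cx !count_cat !count_nseq mul1n mul0n addn0. Qed.

Lemma cy_close p q ts : cy (close p q ts) = (cy ts + gap q (cy ts))%N.
Proof. by rewrite /close /cy !count_cat !count_nseq mul1n mul0n. Qed.

Lemma size_close p q ts :
  size (close p q ts) = (size ts + (gap p (cx ts) + gap q (cy ts)))%N.
Proof. by rewrite /close !size_cat !size_nseq. Qed.

Lemma wgt_close (x y : seq Sigma) p q ts L K :
  (wgt (lab x y (close p q ts) L K) <=
   wgt (lab x y ts L K) + (gap p (cx ts) + gap q (cy ts)))%N.
Proof.
rewrite lab_cat wgt_cat leq_add2l (leq_trans (wgt_size _)) //.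
by rewrite size_lab size_cat !size_nseq.
Qed.

Lemma proper_close p q ts : proper ts -> proper (close p q ts).
Proof. by rewrite /proper !all_cat !all_nseq !orbT !andbT. Qed.

End Closing.

(** With [K = n + m] the terms stand for closing the walks, trimming and padding the rows, and
    trimming and padding the columns; the right-hand side is [pathC]. *)
Lemma pathC_arith (K x y : nat) :
  (K * (x + y) + K.+1 * x + K.+1 * x + K * y + K * y <= 3 * K.+1 * (x + y))%N.
Proof.
have -> : (3 * K.+1 * (x + y) =
  K * (x + y) + K.+1 * x + K.+1 * x + K * y + K * y + (x + 3 * y))%N by ring.
exact: leq_addr.
Qed.

(** * Bounding [Fmin] by the ratio of an edit path *)

Section LowerBound.
Context (R : realType) (Sigma : eqType) (n m r : nat)
  (xs : 'I_n -> seq Sigma) (ys : 'I_m -> seq Sigma) (v : 'I_r -> 'I_m -> nat).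
Hypothesis xs0 : forall i, xs i != [::].
Hypothesis ys0 : forall j, ys j != [::].
Hypothesis n0 : (0 < n)%N.
Hypothesis m0 : (0 < m)%N.
Implicit Types (z : walk R n m) (Z : seq (walk R n m)) (pi : {set 'I_n * 'I_m}).

Definition lenX : nat := (\sum_i sx xs i)%N.
Definition lenY : nat := (\sum_j sy ys j)%N.
Definition pathC : nat := (3 * (n + m).+1 * (lenX + lenY))%N.

Lemma sx_lenX i : (sx xs i <= lenX)%N.
Proof. by rewrite /lenX (bigD1 i) //= leq_addr. Qed.

Lemma sy_lenY j : (sy ys j <= lenY)%N.
Proof. by rewrite /lenY (bigD1 j) //= leq_addr. Qed.

Definition wclose z : walk R n m :=
  (1, wcell z, close (sx xs (wcell z).1) (sy ys (wcell z).2) (wmoves z), wL z, wK z).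

(* The case [len = 0] is kept apart because a row with zero prescribed content
   must remain empty. *)
Lemma closing_sum (T : Type) (s : seq T) (Pr : pred T) (F : T -> nat) (p len c : nat) :
  (0 < p)%N -> (\sum_(z <- s | Pr z) F z = len * p)%N -> (size s <= c)%N ->
  (len * p <= \sum_(z <- s | Pr z) (F z + gap p (F z)) <=
     if len == 0 then 0 else (len + c) * p)%N.
Proof.
move=> p0 E sc; apply/andP; split; first by rewrite big_split /= E leq_addr.
rewrite big_split /= E; case: eqP => [len0|_].
  rewrite len0 mul0n add0n leqn0; move: E; rewrite len0 mul0n {sc}.
  elim: s => [|z s IH]; first by rewrite !big_nil.
  rewrite !big_cons; case: ifP => // _ /eqP; rewrite addn_eq0 => /andP[/eqP -> /eqP E].
  by rewrite gap0 IH.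
rewrite mulnDl leq_add2l.
apply: (@leq_trans (size s * p)); last by rewrite leq_mul2r sc orbT.
rewrite -sum1_size big_distrl /= [X in (_ <= X)%N](bigID Pr) /=.
apply: leq_trans (leq_addr _ _); apply: leq_sum => z _.
by rewrite mul1n gap_le.
Qed.

Lemma closed_cells (nu' : 'I_n -> nat) (mu' : 'I_m -> nat) P :
  is_edit_path P (wordX xs nu') (wordX ys mu') ->
  exists pi Z, [/\ is_interleaving pi, {in Z, forall z, wok xs ys pi z},
    Wsum xs ys Z <= (wgt P + (n + m) * (lenX + lenY))%:R /\ (size P)%:R <= Ssum Z,
    (forall i, (nu' i * sx xs i)%:R <= rowsum Z i /\
        rowsum Z i <= (if nu' i == 0 then 0 else (nu' i + (n + m)) * sx xs i)%N%:R) &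
    (forall j, (mu' j * sy ys j)%:R <= colsum Z j /\
        colsum Z j <= (if mu' j == 0 then 0 else (mu' j + (n + m)) * sy ys j)%N%:R)].
Proof.
move=> H; have [pi [Z [piI Zp [sz wg cnt] row col]]] := wordX_cells R xs0 ys0 n0 m0 H.
exists pi, [seq wclose z | z <- Z]; split => //.
- move=> _ /mapP[z /Zp [h1 h2 h3] ->]; split; rewrite /wcell /wamt /wmoves //=.
  + exact: proper_close.
  + by rewrite cx_close gap_dvd // sx_gt0.
  + by rewrite cy_close gap_dvd // sy_gt0.
- rewrite /Wsum /Ssum !big_map; split.
    under eq_bigr => z _ do rewrite /wamt /= mul1r.
    rewrite -natr_sum ler_nat -wg.
    apply: (@leq_trans (\sum_(z <- Z) (wcost xs ys z + (lenX + lenY)))%N).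
      apply: leq_sum => z _; rewrite /wcost /wcell /wmoves /=.
      apply: (leq_trans (wgt_close _ _ _ _ _ _ _)); rewrite leq_add2l leq_add //.
        by rewrite (leq_trans (gap_le _ _)) ?sx_lenX // sx_gt0.
      by rewrite (leq_trans (gap_le _ _)) ?sy_lenY // sy_gt0.
    by rewrite big_split /= leq_add2l big_const_seq count_predT iter_addn_0 mulnC leq_mul2r cnt orbT.
  under eq_bigr => z _ do rewrite /wamt /= mul1r.
  rewrite -natr_sum ler_nat -sz; apply: leq_sum => z _.
  by rewrite /wmoves /= size_close leq_addr.
- move=> i; rewrite /rowsum big_map.
  under eq_bigr => z _ do rewrite /wamt /= mul1r.
  rewrite -natr_sum !ler_nat; apply/andP.
  have := closing_sum (sx_gt0 xs0 i) (row i) cnt.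
  set A := (\sum_(z <- Z | _) _)%N; set B := (\sum_(j <- Z | _) _)%N.
  suff -> : A = B by [].
  by apply: eq_bigr => z /eqP zi; rewrite /wmoves /= cx_close zi.
move=> j; rewrite /colsum big_map.
under eq_bigr => z _ do rewrite /wamt /= mul1r.
rewrite -natr_sum !ler_nat; apply/andP.
have := closing_sum (sy_gt0 ys0 j) (col j) cnt.
set A := (\sum_(z <- Z | _) _)%N; set B := (\sum_(j <- Z | _) _)%N.
suff -> : A = B by [].
by apply: eq_bigr => z /eqP zi; rewrite /wmoves /= cy_close zi.
Qed.

Lemma Fmin_le (a : 'rV[R^o]_n) pi f tau lam : is_interleaving pi ->
  LP_feasible xs ys v a pi f tau lam -> Fmin xs ys v a <= LP_obj xs ys f pi.
Proof.
move=> piI feas; apply: le_trans (OPT_le feas); apply: ge_inf; last by exists pi.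
by exists 0 => _ [pi' _ <-]; exact: OPT_ge0.
Qed.

(** Rows can only be padded upwards, to the target [N * a], so [nu] is first trimmed below itself
    and below that target. The letters removed and the letters padded each see the distance between
    [nu] and [N * a] once, hence the factor 2 in [D]. *)
Lemma Fmin_le_path nu mu P (a : 'rV[R^o]_n) (N : R) (t : 'I_r -> nat) :
  is_edit_path P (wordX xs nu) (wordX ys mu) ->
  (forall j, mu j = (\sum_(s < r) t s * v s j)%N) ->
  (forall i, 0 <= a ord0 i) -> \sum_i (sx xs i)%:R * a ord0 i = 1 -> 0 < N ->
  let D : R := 2 * (\sum_i (sx xs i)%:R * `|N * a ord0 i - (nu i)%:R|) + pathC%:R in
  D < (size P)%:R ->
  Fmin xs ys v a <= ((wgt P)%:R + D) / ((size P)%:R - D).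
Proof.
move=> HP muE a0 a1 N0 D DP.
pose K := (n + m)%N.
pose na i := Num.truncn (N * a ord0 i).
have na_bnd i : (na i)%:R <= N * a ord0 i < (na i).+1%:R.
  by apply: truncn_itv; rewrite mulr_ge0 // ltW.
(* Trimming each block by one period per cell leaves the room needed to close
   the walks of the cells. *)
pose nu' i := minn (nu i) (na i - K).
pose mu' j := (mu j - K)%N.
have nu'le i : (nu' i <= nu i)%N by rewrite geq_minl.
have mu'le j : (mu' j <= mu j)%N by rewrite leq_subr.
have [P1 [HP1 wP1 sP1]] := edit_path_subseq (subseq_wordX xs nu'le) HP.
have [P2 [HP2 wP2 sP2]] :=
  edit_path_subseq (subseq_wordX ys mu'le) (eswap_edit_path HP1).
have {}HP2 := eswap_edit_path HP2.
have [pi [Z [piI Zok [WZ SZ] row col]]] := closed_cells HP2.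
rewrite !wgt_eswap !size_eswap in wP2 sP2 WZ SZ.
rewrite !size_wordX in wP1 sP1 wP2 sP2.
pose rX := (\sum_i nu i * sx xs i - \sum_i nu' i * sx xs i)%N.
pose rY := (\sum_j mu j * sy ys j - \sum_j mu' j * sy ys j)%N.
(* Columns are padded back up to [mu], not to [mu']: their right-hand side has to be a combination
   of the period vectors, and [mu] is one. *)
pose tR s : R := (t s)%:R.
have muR j : \sum_(s < r) tR s * (v s j)%:R = (mu j)%:R.
  by rewrite muE natr_sum; apply: eq_bigr => s _; rewrite natrM.
have rowL i : rowsum Z i <= (sx xs i)%:R * a ord0 i * N.
  have [_ ub] := row i; apply: le_trans ub _; case: eqP => [_|nz].
    by rewrite mulr_ge0 ?mulr_ge0 // ltW.
  have /andP[h _] := na_bnd i.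
  rewrite -mulrA [a ord0 i * N]mulrC natrM [X in X <= _]mulrC ler_wpM2l //.
  by apply: le_trans h; rewrite ler_nat; move: nz; rewrite /nu' /K; lia.
have colL j : colsum Z j <= (sy ys j)%:R * (\sum_(s < r) tR s * (v s j)%:R).
  have [_ ub] := col j; apply: le_trans ub _; rewrite muR; case: eqP => [_|nz].
    by rewrite mulr_ge0.
  rewrite mulnC natrM ler_wpM2l // ler_nat; move: nz; rewrite /mu' /K; lia.
have t0 s : 0 <= tR s by rewrite ler0n.
pose g : R := \sum_i ((sx xs i)%:R * a ord0 i * N - rowsum Z i) +
  \sum_j ((sy ys j)%:R * (\sum_(s < r) tR s * (v s j)%:R) - colsum Z j).
have [S0 [f [tau [lam [feas obj]]]]] : 0 < Ssum Z + g /\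
  exists f tau lam, LP_feasible xs ys v a pi f tau lam /\
    LP_obj xs ys f pi = (Wsum xs ys Z + g) / (Ssum Z + g) :=
  LP_of_padded_walks xs0 ys0 piI Zok N0 a1 rowL t0 colL.
have g0 : 0 <= g by rewrite addr_ge0 // sumr_ge0 // => i _; rewrite subr_ge0.
have W0 : 0 <= Wsum xs ys Z.
  rewrite /Wsum big_seq sumr_ge0 // => z /Zok [_ ? _ _ _].
  by rewrite mulr_ge0.
apply: le_trans (Fmin_le piI feas) _; rewrite obj.
pose E : R := \sum_i (sx xs i)%:R * `|N * a ord0 i - (nu i)%:R|.
(* In [K.+1], [K] periods account for the trimming and one for rounding [N * a] down. *)
have XB : (\sum_i (sx xs i)%:R * (N * a ord0 i - (nu' i)%:R)) <= E + (K.+1 * lenX)%:R.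
  rewrite /E natrM /lenX natr_sum mulr_sumr -big_split /=; apply: ler_sum => i _.
  rewrite [K.+1%:R * _]mulrC -mulrDr ler_wpM2l //.
  have /andP[h1 h2] := na_bnd i.
  have [le|lt] := leqP (nu i) (na i - K).
    rewrite /nu' (minn_idPl le); apply: le_trans (ler_norm _) _.
    by rewrite lerDl.
  rewrite /nu' (minn_idPr (ltnW lt)).
  have h3 : (na i)%:R - K%:R <= (na i - K)%:R :> R.
    by rewrite lerBlDr -natrD ler_nat addnC -leq_subLR.
  have := normr_ge0 (N * a ord0 i - (nu i)%:R).
  rewrite -natr1 in h2; rewrite -natr1; lra.
have RXB : rX%:R <= E + (K.+1 * lenX)%:R.
  have -> : rX%:R = \sum_i (sx xs i)%:R * ((nu i)%:R - (nu' i)%:R) :> R.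
    rewrite /rX natrB; last by apply: leq_sum => i _; rewrite leq_mul2r nu'le orbT.
    rewrite !natr_sum -sumrB; apply: eq_bigr => i _.
    by rewrite !natrM -mulrBl mulrC.
  rewrite /E natrM /lenX natr_sum mulr_sumr -big_split /=; apply: ler_sum => i _.
  rewrite [K.+1%:R * _]mulrC -mulrDr ler_wpM2l //.
  have /andP[h1 h2] := na_bnd i.
  have nn := normr_ge0 (N * a ord0 i - (nu i)%:R).
  have [le|lt] := leqP (nu i) (na i - K).
    by rewrite /nu' (minn_idPl le) subrr addr_ge0.
  rewrite /nu' (minn_idPr (ltnW lt)).
  have h3 : (na i)%:R - K%:R <= (na i - K)%:R :> R.
    by rewrite lerBlDr -natrD ler_nat addnC -leq_subLR.
  have h4 := ler_norm ((nu i)%:R - N * a ord0 i); rewrite distrC in h4.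
  rewrite -natr1 in h2; rewrite -natr1; lra.
have YB : (\sum_j (mu j - mu' j) * sy ys j <= K * lenY)%N.
  rewrite /lenY big_distrr /=; apply: leq_sum => j _.
  by rewrite leq_mul2r; apply/orP; right; rewrite leq_subLR addnC -leq_subLR.
have RYB : (rY <= K * lenY)%N.
  apply: leq_trans YB; rewrite /rY leq_subLR -big_split /=.
  by apply: leq_sum => j _; rewrite -mulnDl subnKC.
have gB : g <= E + (K.+1 * lenX)%:R + (K * lenY)%:R.
  apply: lerD.
    apply: le_trans XB; apply: ler_sum => i _; have [lb _] := row i.
    rewrite mulrBr -[X in X - _]mulrA [a ord0 i * N]mulrC lerB //.
    by rewrite -natrM mulnC.
  apply: (@le_trans _ _ (\sum_j (mu j - mu' j) * sy ys j)%:R); last by rewrite ler_nat.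
  rewrite natr_sum; apply: ler_sum => j _; have [lb _] := col j.
  rewrite muR natrM natrB // mulrBl; apply: lerB; first by rewrite mulrC.
  by rewrite -natrM.
have wB : (wgt P2 <= wgt P + rX + rY)%N.
  by apply: leq_trans wP2 _; rewrite leq_add2r.
have sB : (size P <= size P2 + rY + rX)%N.
  by apply: leq_trans sP1 _; rewrite leq_add2r.
have wBR : (wgt P2)%:R <= (wgt P)%:R + rX%:R + rY%:R :> R by rewrite -!natrD ler_nat.
have sBR : (size P)%:R <= (size P2)%:R + rY%:R + rX%:R :> R by rewrite -!natrD ler_nat.
have RYR : rY%:R <= (K * lenY)%:R :> R by rewrite ler_nat.
have cB : (K * (lenX + lenY))%:R + (K.+1 * lenX)%:R + (K.+1 * lenX)%:R + (K * lenY)%:R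
   + (K * lenY)%:R <= pathC%:R :> R.
  by rewrite -!natrD ler_nat; exact: pathC_arith.
have DE : D = 2 * E + pathC%:R by [].
have p1 : 0 <= (K * (lenX + lenY))%:R :> R by [].
rewrite natrD -/K in WZ.
have p2 : 0 <= (K * lenY)%:R :> R by [].
have p3 : 0 <= (K.+1 * lenX)%:R :> R by [].
clearbody g; apply: ler_div2; rewrite ?subr_gt0 ?addr_ge0 // DE; lra.
Qed.

End LowerBound.

(** * From circulations to edit paths *)

Section Circulations.
Context (R : realType) (E : finType) (V : eqType) (src tgt : E -> V).
Implicit Types (h : E -> R) (c : seq E).

Definition adj : rel E := fun e e' => tgt e == src e'.

Definition circulation h : Prop :=
  (forall e, 0 <= h e) /\
  forall w, \sum_(e | src e == w) h e = \sum_(e | tgt e == w) h e.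

(** By conservation a positive edge is followed by a positive edge, and a successor function on a
    finite type must loop. The cycle is a list of distinct edges, so it may pass through a vertex
    more than once. The default in [F] is not reached from a positive edge. *)
Lemma positive_cycle h e0 : circulation h -> 0 < h e0 ->
  exists c, [/\ c != [::], uniq c, cycle adj c & {in c, forall e, 0 < h e}].
Proof.
move=> [h0 cons] he0.
pose F e := if [pick e' | (src e' == tgt e) && (0 < h e')] is Some e' then e' else e.
have FP e : 0 < h e -> src (F e) = tgt e /\ 0 < h (F e).
  move=> he; rewrite /F; case: pickP => [e' /andP[/eqP]//|none].
  have : 0 < \sum_(e' | tgt e' == tgt e) h e'.
    by rewrite (bigD1 e) //= ltr_pwDl // sumr_ge0.
  rewrite -cons big1 ?ltxx // => e' se'; apply/eqP; rewrite eq_le h0 andbT.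
  by have := none e'; rewrite se' /= lt0r h0 andbT => /negbFE/eqP ->.
have pos k : 0 < h (iter k F e0) by elim: k => //= k /FP[].
have /trajectP[i ilt iE] := looping_order F e0.
set o := fingraph.order F e0 in ilt iE.
(* The orbit of [e0] may have a tail before it becomes periodic; [e1] is the entry to the periodic
   part and [k.+1] its length. *)
pose e1 := iter i F e0; pose k := (o - i).-1.
have oE : o = (i + k.+1)%N by rewrite /k; lia.
have e1E : iter k F (F e1) = e1.
  by rewrite -iterSr /e1 -iterD addnC -oE -iE.
exists (traject F e1 k.+1); split => //.
- have := orbit_uniq F e0; rewrite /orbit -/o oE trajectD cat_uniq.
  by case/and3P.
- have allp : all (fun e => 0 < h e) (e1 :: traject F (F e1) k.+1).
    apply/allP => e; rewrite -[_ :: _]/(traject F e1 k.+2) => /trajectP[j _ ->].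
    by rewrite /e1 -iterD.
  have : path (frel F) e1 (traject F (F e1) k.+1) by exact: fpath_traject.
  rewrite trajectSr e1E => pth.
  move: allp; rewrite trajectSr e1E => allp.
  change (path adj e1 (rcons (traject F (F e1) k) e1)).
  apply: (sub_in_path _ allp) pth => e e' he _ /eqP <-.
  by rewrite /adj; have [-> _] := FP e he.
- by move=> e /trajectP[j _ ->]; rewrite /e1 -iterD.
Qed.

Lemma cycle_count (w : V) c : cycle adj c ->
  count (fun e => src e == w) c = count (fun e => tgt e == w) c.
Proof.
case: c => // e c; rewrite /cycle => pth.
have H e1 s : path adj e1 s ->
    (count (fun e => tgt e == w) (belast e1 s) =
     count (fun e => src e == w) s)%N.
  elim: s e1 => //= e2 s IH e1 /andP[/eqP a pth']; rewrite a IH //.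
have := H _ _ pth; rewrite belast_rcons -cats1 count_cat /= => ->.
by rewrite addn0 addnC.
Qed.

Lemma sum_mem_seq c (P : pred E) (F : E -> R) : uniq c ->
  \sum_(e | P e) (e \in c)%:R * F e = \sum_(e <- c | P e) F e.
Proof.
move=> uc; rewrite big_mkcond [RHS]big_mkcond [RHS]big_uniq //= [RHS]big_mkcond.
by apply: eq_bigr => e _; case: (e \in c); case: (P e); rewrite ?mul1r ?mul0r.
Qed.

(* Subtracting from a circulation its minimum along a positive cycle kills at
   least one edge of its support. *)
Lemma circulation_decomp h : circulation h ->
  exists D : seq (R * seq E), [/\ (size D <= #|E|)%N,
    {in D, forall d, [/\ 0 <= d.1, d.2 != [::], uniq d.2 & cycle adj d.2]} &
    forall e, h e = \sum_(d <- D) d.1 * (e \in d.2)%:R].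
Proof.
suff H k g : circulation g -> (#|[set e | g e != 0%R]%SET| <= k)%N ->
  exists D : seq (R * seq E), [/\ (size D <= k)%N,
    {in D, forall d, [/\ 0 <= d.1, d.2 != [::], uniq d.2 & cycle adj d.2]} &
    forall e, g e = \sum_(d <- D) d.1 * (e \in d.2)%:R].
  by move=> hc; apply: H => //; exact: max_card.
elim: k g => [|k IH] g gc.
  rewrite leqn0 cards_eq0 => /eqP g0; exists [::]; split => // e.
  rewrite big_nil; apply/eqP; apply: contraT => ge.
  have : e \in [set e | g e != 0%R]%SET by rewrite inE.
  by rewrite g0 finset.in_set0.
move=> card; have [/existsP[e0 ge0]|none] := boolP [exists e, g e != 0]; last first.
  exists [::]; split => // e; rewrite big_nil; apply/eqP; apply: contraNT none => ge.
  by apply/existsP; exists e.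
have [g0 cons] := gc.
have ge0' : 0 < g e0 by rewrite lt0r ge0 g0.
have [c [c0 uc cc cpos]] := positive_cycle gc ge0'.
have [e1 e1c e1min] : exists2 e1, e1 \in c & forall e, e \in c -> g e1 <= g e.
  have [e2 e2c] : exists e2, e2 \in c.
    by case: c c0 {uc cc cpos} => // e2 c _; exists e2; rewrite mem_head.
  have := Order.TotalTheory.arg_minP (P := mem c) g e2c; case=> e1 h1 h2.
  by exists e1.
pose g' e := g e - g e1 * (e \in c)%:R.
have g'0 e : 0 <= g' e.
  by rewrite subr_ge0; case: (boolP (e \in c)) => [/e1min|]; rewrite ?mulr1 ?mulr0.
have g'c : circulation g'.
  split => // w; rewrite !sumrB cons; congr (_ - _).
  have S (f : E -> V) : \sum_(e | f e == w) g e1 * (e \in c)%:R =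
      g e1 * (count (fun e => f e == w) c)%:R.
    rewrite -mulr_sumr; congr (_ * _).
    under eq_bigr => e _ do rewrite -[(_ \in _)%:R]mulr1.
    by rewrite sum_mem_seq // big_const_seq iter_addr addr0.
  by rewrite !S (cycle_count w cc).
have [|D [sD Dok DE]] := IH g' g'c.
  rewrite -ltnS; apply: leq_trans card; apply: proper_card; apply/properP; split.
    apply/fintype.subsetP => e; rewrite !inE /g'; case: (boolP (e \in c)) => [/cpos ge _|].
      by rewrite gt_eqF.
    by rewrite mulr0 subr0.
  exists e1; rewrite !inE; first by rewrite gt_eqF // cpos.
  by rewrite /g' e1c mulr1 subrr eqxx.
exists ((g e1, c) :: D); split => //.
- move=> d; rewrite inE => /predU1P[->|/Dok //].
  by split => //=; rewrite ltW // cpos.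
- by move=> e; rewrite big_cons -DE /g' /= addrC subrK.
Qed.

Lemma decomp_sum h (D : seq (R * seq E)) (F : E -> R) :
  {in D, forall d, uniq d.2} -> (forall e, h e = \sum_(d <- D) d.1 * (e \in d.2)%:R) ->
  \sum_(d <- D) d.1 * (\sum_(e <- d.2) F e) = \sum_e h e * F e.
Proof.
move=> uD hE; under [RHS]eq_bigr => e _ do rewrite hE mulr_suml.
rewrite exchange_big /= big_seq [RHS]big_seq; apply: eq_bigr => d /uD ud.
rewrite -(sum_mem_seq predT) // mulr_sumr; apply: eq_bigr => e _.
by rewrite mulrA.
Qed.

End Circulations.

(** * Edit paths following cycles and circulations *)

Section CyclePaths.
Context (R : realType) (Sigma : eqType) (x y : seq Sigma).
Hypothesis x0 : x != [::].
Hypothesis y0 : y != [::].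
Let p := size x.
Let q := size y.
Let E := size (edges p q).

Definition emove (e : edge) : move := (e.1.1 != 1%N, e.1.1 != 0%N).

Lemma emove_ind el : (cx [seq emove e | e <- el] = \sum_(e <- el) ind_x e)%N /\
  (cy [seq emove e | e <- el] = \sum_(e <- el) ind_y e)%N.
Proof.
elim: el => [|[[t l] k] el [IH1 IH2]]; first by rewrite !big_nil.
by rewrite !big_cons -IH1 -IH2.
Qed.

Arguments emove : simpl never.

Lemma size_x_gt0 : (0 < p)%N. Proof. by rewrite /p; case: x x0. Qed.
Lemma size_y_gt0 : (0 < q)%N. Proof. by rewrite /q; case: y y0. Qed.

Lemma emove_step e L K : e \in edges p q -> esrc p q e = (L %% p, K %% q)%N ->
  [/\ emove e != (false, false),
   etgt p q e = ((L + (emove e).1) %% p, (K + (emove e).2) %% q)%N &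
   wgt (lab x y [:: emove e] L K) = ecost x y e].
Proof.
case: e => [[t l] k]; rewrite mem_edges => tlk [lL kK].
have Sm a b d : (a %% d = b %% d)%N -> (a.+1 %% d = (b + 1) %% d)%N.
  by move=> h; rewrite -addn1 -modnDml h modnDml.
have ox := onth_mod L x0; have oy := onth_mod K y0.
case/or3P: tlk => /and3P[/eqP -> h1 h2]; rewrite /emove /=.
- split; rewrite ?addn0 ?(Sm l L) ?kK //.
  by rewrite /wgt /=; case: onth ox.
- split; rewrite ?addn0 ?(Sm k K) ?lL //.
  by rewrite /wgt /=; case: onth oy.
split; rewrite ?(Sm l L) ?(Sm k K) //.
rewrite /wgt /= -/p -/q -lL -kK !modn_small //.
move: ox oy; rewrite -/p -/q -lL -kK !modn_small //.
case: onth => [b|] //=; case: onth => [c|] //= _ _.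
by rewrite -[Some b == Some c]/(b == c); case: (b == c).
Qed.

Let erel : rel edge := fun e e' => etgt p q e == esrc p q e'.

Lemma emove_path e el L K : path erel e el -> {subset e :: el <= edges p q} ->
  esrc p q e = (L %% p, K %% q)%N ->
  let ts := [seq emove e | e <- e :: el] in
  [/\ proper ts,
   etgt p q (last e el) = ((L + cx ts) %% p, (K + cy ts) %% q)%N &
   wgt (lab x y ts L K) = \sum_(e <- e :: el) ecost x y e]%N.
Proof.
elim: el e L K => [|e' el IH] e L K.
  move=> _ sub se; have [] := emove_step (sub e (mem_head _ _)) se.
  move=> a b c; split; [by rewrite /proper /= a|by rewrite /cx /cy /= !addn0|].
  by rewrite big_seq1 -c.
move=> /= /andP[/eqP ee' pth] sub se.
have [h1 h2 h3] := emove_step (sub e (mem_head _ _)) se.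
have sub' : {subset e' :: el <= edges p q} by move=> a ha; apply: sub; rewrite inE ha orbT.
have [i1 i2 i3] := IH e' _ _ pth sub' (esym (etrans (esym h2) ee')).
split; first by apply/andP; split.
  by rewrite i2 -!addnA.
by rewrite big_cons -h3 -i3 -wgt_cat.
Qed.

Lemma lab_mod ts L K L' K' : (L %% p = L' %% p)%N -> (K %% q = K' %% q)%N ->
  lab x y ts L K = lab x y ts L' K'.
Proof.
elim: ts L K L' K' => //= m ts IH L K L' K' a b.
rewrite -/p -/q a b; congr (_ :: _); apply: IH.
  by rewrite -modnDml a modnDml.
by rewrite -modnDml b modnDml.
Qed.

Lemma wgt_laps ts L K k : (p %| cx ts)%N -> (q %| cy ts)%N ->
  wgt (lab x y (flatten (nseq k ts)) L K) = (k * wgt (lab x y ts L K))%N.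
Proof.
move=> dx dy; elim: k => //= k IH; rewrite lab_cat wgt_cat mulSn; congr (_ + _)%N.
rewrite -IH; congr wgt; apply: lab_mod.
  by case/dvdnP: dx => a ->; rewrite addnC modnMDl.
by case/dvdnP: dy => a ->; rewrite addnC modnMDl.
Qed.

(* [a] and [b] are the numbers of letters read from the two words, [w] the weight
   and [s] the length, all up to an error [C]. *)
Definition near_path (C : R) (a b w s : R) : Prop :=
  exists A B P, [/\ is_edit_path P (flatten (nseq A x)) (flatten (nseq B y)),
    `|(A * p)%:R - a| <= C, `|(B * q)%:R - b| <= C, (wgt P)%:R <= w + C &
    s - C <= (size P)%:R].

Lemma near_path0 : near_path 0 0 0 0 0.
Proof. by exists 0%N, 0%N, [::]; split; rewrite ?subrr ?normr0 ?addr0. Qed.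

(** The paths link full powers of [x] and [y], so they start and end at the base vertex;
    concatenation is then possible and the errors add up. *)
Lemma near_pathD C1 a1 b1 w1 s1 C2 a2 b2 w2 s2 :
  near_path C1 a1 b1 w1 s1 -> near_path C2 a2 b2 w2 s2 ->
  near_path (C1 + C2) (a1 + a2) (b1 + b2) (w1 + w2) (s1 + s2).
Proof.
move=> [A1 [B1 [P1 [e1 x1 y1 v1 u1]]]] [A2 [B2 [P2 [e2 x2 y2 v2 u2]]]].
exists (A1 + A2)%N, (B1 + B2)%N, (P1 ++ P2); split.
- by rewrite !nseqD !flatten_cat; exact: edit_path_cat.
- rewrite mulnDl natrD opprD addrACA; apply: le_trans (ler_normD _ _) _; exact: lerD.
- rewrite mulnDl natrD opprD addrACA; apply: le_trans (ler_normD _ _) _; exact: lerD.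
- by rewrite wgt_cat natrD addrACA lerD.
- by rewrite size_cat natrD opprD addrACA lerD.
Qed.

(** In the error [E + p + q], rounding [al] down loses at most one lap, which has at most [E] edges
    because none is repeated, and joining the cycle to the base vertex takes [p + q] moves. *)
Lemma near_path_cycle (al : R) el : 0 <= al -> el != [::] -> uniq el ->
  {subset el <= edges p q} -> cycle erel el ->
  near_path (E + p + q)%:R (al * (\sum_(e <- el) (ind_x e)%:R))
    (al * (\sum_(e <- el) (ind_y e)%:R)) (al * (\sum_(e <- el) (ecost x y e)%:R))
    (al * (size el)%:R).
Proof.
move=> al0; case: el => // e el _ ue sub cyc_el.
have sE : (size (e :: el) <= E)%N by apply: uniq_leq_size.
pose v1 := (esrc p q e).1; pose v2 := (esrc p q e).2.
have [v1p v2q] : (v1 < p)%N /\ (v2 < q)%N.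
  by rewrite /v1 /v2 /esrc; case: e {cyc_el ue sub sE v1 v2} => [[t l] k] /=;
    rewrite !ltn_mod size_x_gt0 size_y_gt0.
have srcE : esrc p q e = (v1 %% p, v2 %% q)%N.
  by rewrite !modn_small // /v1 /v2; case: esrc.
pose ts := [seq emove e | e <- e :: el].
have pth : path erel e el by move: cyc_el; rewrite /= rcons_path => /andP[].
have [pr tE wE] := emove_path pth sub srcE; rewrite -/ts in pr tE wE.
have lastE : etgt p q (last e el) = esrc p q e.
  by move: cyc_el; rewrite /= rcons_path => /andP[_ /eqP].
rewrite lastE srcE in tE; case: tE => tx ty.
have dx : (p %| cx ts)%N.
  by have /eqP := tx; rewrite -{1}[v1]addn0 eqn_modDl mod0n eq_sym.
have dy : (q %| cy ts)%N.
  by have /eqP := ty; rewrite -{1}[v2]addn0 eqn_modDl mod0n eq_sym.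
pose k := Num.truncn al.
have /andP[k1 k2] : k%:R <= al < k.+1%:R by exact: truncn_itv.
(* [M1] leads from the base vertex to the source of the cycle and [M2] leads on to the base vertex.
   Together they read each of the two words exactly once, so the contents stay divisible by the
   periods. *)
pose M1 := nseq v1 (true, false) ++ nseq v2 (false, true).
pose M2 := nseq (p - v1) (true, false) ++ nseq (q - v2) (false, true).
pose M := M1 ++ flatten (nseq k ts) ++ M2.
have cxc a b : cx (nseq a (true, false) ++ nseq b (false, true)) = a.
  by rewrite /cx count_cat !count_nseq mul1n mul0n addn0.
have cyc2 a b : cy (nseq a (true, false) ++ nseq b (false, true)) = b.
  by rewrite /cy count_cat !count_nseq mul1n mul0n.
have cflat (f : move -> bool) : count f (flatten (nseq k ts)) = (k * count f ts)%N.
  by rewrite count_flatten map_nseq sumnE big_nseq iter_addn_0 mulnC.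
have cxM : cx M = (k * cx ts + p)%N.
  rewrite /M /M1 /M2 {1}/cx !count_cat !count_nseq cflat -/(cx ts) !mul1n !mul0n.
  by clear - v1p; move: (k * _)%N v1 p v1p => z a c *; lia.
have cyM : cy M = (k * cy ts + q)%N.
  rewrite /M /M1 /M2 {1}/cy !count_cat !count_nseq cflat -/(cy ts) !mul1n !mul0n.
  by clear - v2q; move: (k * _)%N v2 q v2q => z a c *; lia.
have prM : proper M.
  rewrite /M /M1 /M2 /proper !all_cat !all_nseq !orbT /= !andbT.
  by elim: (k) => // j IH; rewrite -[nseq _ _]/(ts :: nseq j ts) /= all_cat IH andbT.
have szM : size M = (k * size (e :: el) + (p + q))%N.
  have -> : size M = (v1 + v2 + (k * size (e :: el) + ((p - v1) + (q - v2))))%N.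
    rewrite /M /M1 /M2 !size_cat !size_nseq -[size (flatten _)]count_predT cflat.
    by rewrite count_predT size_map.
  move: (k * size _)%N => z; clear - v1p v2q.
  by move: v1 v2 p q v1p v2q => a b c d *; lia.
have wM : (wgt (lab x y M 0 0) <= k * (\sum_(e <- e :: el) ecost x y e) + (p + q))%N.
  rewrite /M lab_cat wgt_cat lab_cat wgt_cat !add0n cxc cyc2 wgt_laps // wE.
  rewrite addnCA leq_add2l; apply: (@leq_trans (size M1 + size M2)).
    by apply: leq_add; rewrite (leq_trans (wgt_size _)) ?size_lab.
  rewrite /M1 /M2 !size_cat !size_nseq; clear - v1p v2q.
  by move: v1 v2 p q v1p v2q => a b c d *; lia.
have dxM : (p %| cx M)%N by rewrite cxM dvdn_add ?dvdn_mull.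
have dyM : (q %| cy M)%N by rewrite cyM dvdn_add ?dvdn_mull.
have [indx indy] := emove_ind (e :: el).
have round (c : nat) : (c <= E)%N -> k%:R * c%:R <= al * c%:R /\
    al * c%:R - E%:R <= k%:R * c%:R.
  move=> cE; split; first by rewrite ler_wpM2r.
  rewrite lerBlDr; apply: (@le_trans _ _ (k.+1%:R * c%:R)).
    by rewrite ler_wpM2r // ltW.
  by rewrite -natr1 mulrDl mul1r lerD2l ler_nat.
have p_ge0 : 0 <= p%:R :> R by [].
have q_ge0 : 0 <= q%:R :> R by [].
have E_ge0 : 0 <= E%:R :> R by [].
exists (cx M %/ p)%N, (cy M %/ q)%N, (lab x y M 0 0); split.
- by rewrite -!cyc_laps // !divnK //; exact: lab_edit_path.
- rewrite divnK // cxM -natr_sum -indx -/ts.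
  have [|] := round (cx ts).
    by apply: leq_trans sE; rewrite -(size_map emove); exact: count_size.
  move: (cx ts) => c r1 r2; rewrite !natrD natrM ler_norml.
  by apply/andP; split; lra.
- rewrite divnK // cyM -natr_sum -indy -/ts.
  have [|] := round (cy ts).
    by apply: leq_trans sE; rewrite -(size_map emove); exact: count_size.
  move: (cy ts) => c r1 r2; rewrite !natrD natrM ler_norml.
  by apply/andP; split; lra.
- rewrite -natr_sum; apply: (@le_trans _ _ (k * (\sum_(e <- e :: el) ecost x y e) + (p + q))%:R).
    by rewrite ler_nat.
  have le : k%:R * (\sum_(e <- e :: el) ecost x y e)%:R <=
    al * (\sum_(e <- e :: el) ecost x y e)%:R by rewrite ler_wpM2r.
  by rewrite !natrD natrM; lra.
- rewrite size_lab szM !natrD natrM; have [r1 r2] := round _ sE.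
  by lra.
Qed.

Lemma near_path_circulation (f : edge -> R) :
  (forall e, 0 <= f e) ->
  (forall w, w \in vertices p q ->
    \sum_(e <- edges p q | esrc p q e == w) f e =
    \sum_(e <- edges p q | etgt p q e == w) f e) ->
  near_path (E * (E + p + q))%:R
    (\sum_(e <- edges p q) f e * (ind_x e)%:R)
    (\sum_(e <- edges p q) f e * (ind_y e)%:R)
    (\sum_(e <- edges p q) f e * (ecost x y e)%:R)
    (\sum_(e <- edges p q) f e).
Proof.
(* Indexing the edges by ordinals provides the finite type on which circulations are decomposed. *)
move=> f0 cons; pose es (i : 'I_E) := nth (0%N, 0%N, 0%N) (edges p q) i.
have bigE (P : pred edge) (F : edge -> R) :
    \sum_(e <- edges p q | P e) F e = \sum_(i | P (es i)) F (es i).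
  by rewrite (big_nth (0%N, 0%N, 0%N)) big_mkord.
have esin i : es i \in edges p q by rewrite mem_nth.
have esinj : injective es.
  move=> i j /eqP; rewrite nth_uniq ?uniq_edges // => /eqP; exact: val_inj.
have vert l k : (l %% p, k %% q)%N \in vertices p q.
  apply/allpairsP; exists (l %% p, k %% q)%N.
  by rewrite !mem_iota /= !add0n !ltn_mod size_x_gt0 size_y_gt0.
have circ : circulation (esrc p q \o es) (etgt p q \o es) (f \o es).
  split => [i|w] /=; first exact: f0.
  rewrite -(bigE (fun e => esrc p q e == w)) -(bigE (fun e => etgt p q e == w)).
  (* [circulation] asks for conservation at every pair of numbers; at a pair outside [vertices] no
     edge starts or ends. *)
  have [wv|wv] := boolP (w \in vertices p q); first exact: cons.
  rewrite !big1 // => -[[t l] k] /eqP ew; case/negP: wv; rewrite -ew /=.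
    by case: ifP => _; [|case: ifP => _]; exact: vert.
  exact: vert.
have [D [sD Dok fE]] := circulation_decomp circ.
have val (F : edge -> R) : \sum_(d <- D) d.1 * (\sum_(i <- d.2) F (es i)) =
    \sum_(e <- edges p q) f e * F e.
  rewrite (bigE predT) -(decomp_sum _ _ fE) // => d /Dok[] //.
rewrite -(val (fun e => (ind_x e)%:R)) -(val (fun e => (ind_y e)%:R)).
rewrite -(val (fun e => (ecost x y e)%:R)).
have -> : \sum_(e <- edges p q) f e = \sum_(d <- D) d.1 * (size d.2)%:R.
  under eq_bigr => e _ do rewrite -[f e]mulr1.
  rewrite -(val (fun=> 1)); apply: eq_bigr => d _.
  by rewrite big_const_seq count_predT iter_addr addr0.
rewrite card_ord in sD.
suff : near_path (size D * (E + p + q))%:R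
  (\sum_(d <- D) d.1 * (\sum_(i <- d.2) (ind_x (es i))%:R))
  (\sum_(d <- D) d.1 * (\sum_(i <- d.2) (ind_y (es i))%:R))
  (\sum_(d <- D) d.1 * (\sum_(i <- d.2) (ecost x y (es i))%:R))
  (\sum_(d <- D) d.1 * (size d.2)%:R).
  move=> [A [B [P [e1 a1 b1 w1 s1]]]]; exists A, B, P.
  have le : (size D * (E + p + q))%:R <= (E * (E + p + q))%:R :> R.
    by rewrite ler_nat leq_mul2r sD orbT.
  split => //; [exact: le_trans a1 le|exact: le_trans b1 le| |].
    by apply: le_trans w1 _; rewrite lerD2l.
  by apply: le_trans s1; rewrite lerB.
elim: D Dok {sD fE val} => [_|d D IH Dok].
  by rewrite !big_nil mul0n; exact: near_path0.
rewrite !big_cons /= mulSn natrD; apply: near_pathD; last first.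
  by apply: IH => d' h; apply: Dok; rewrite inE h orbT.
have [d1 d2 d3 d4] := Dok d (mem_head _ _).
have mp (F : edge -> R) : \sum_(i <- d.2) F (es i) = \sum_(e <- map es d.2) F e.
  by rewrite big_map.
rewrite (mp (fun e => (ind_x e)%:R)) (mp (fun e => (ind_y e)%:R)).
rewrite (mp (fun e => (ecost x y e)%:R)) -(size_map es).
apply: near_path_cycle => //.
- by case: (d.2) d2.
- by rewrite map_inj_uniq.
- by move=> _ /mapP[i _ ->].
- by rewrite cycle_map.
Qed.

End CyclePaths.

(** * Concatenation along an interleaving and correction of exponents *)

Section Concatenation.
Context (Sigma : eqType).

(** Keys never decrease and never skip a value along the path, so the powers of one word are
    adjacent and merge into a power with the summed exponent. Words after the last key get exponent
    0. *)
Lemma flatten_keys (n : nat) (xs : 'I_n -> seq Sigma) (T : eqType) (e : rel T)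
    (key : T -> 'I_n) (A : T -> nat) c s :
  (forall c d, e c d -> key d = key c \/ key d = (key c).+1 :> nat) -> path e c s ->
  flatten [seq flatten (nseq (A d) (xs (key d))) | d <- c :: s] =
  flatten [seq flatten (nseq (\sum_(d <- c :: s | key d == i) A d)%N (xs i))
     | i <- drop (key c) (enum 'I_n)].
Proof.
move=> He; elim: s c => [|c' s IH] c pth.
  rewrite drop_enum /= big_cons big_nil eqxx addn0.
  rewrite (_ : [seq _ | i <- drop _ _] = nseq (size (drop (key c).+1 (enum 'I_n))) [::]).
    have Z k : flatten (nseq k [::]) = [::] :> seq Sigma by elim: k.
    by rewrite Z.
  have : key c \notin drop (key c).+1 (enum 'I_n).
    by have := drop_uniq (key c) (enum_uniq 'I_n); rewrite drop_enum => /andP[].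
  elim: (drop _ _) => //= i l IHl; rewrite inE negb_or => /andP[ne nl].
  by rewrite big_cons big_nil (negbTE ne) IHl.
have key_ge : forall d, d \in c' :: s -> (key c' <= key d)%N.
  move: pth => /= /andP[_]; elim: s c' {IH} => [|c2 s IH] c1.
    by move=> _ d; rewrite inE => /eqP ->.
  move=> /= /andP[e12 pth] d; rewrite inE => /predU1P[->//|ds].
  apply: leq_trans (IH _ pth d ds).
  by case: (He _ _ e12) => [->//|->].
have kc : key c \notin drop (key c).+1 (enum 'I_n).
  by have := drop_uniq (key c) (enum_uniq 'I_n); rewrite drop_enum => /andP[].
have tailE : [seq flatten (nseq (\sum_(d <- [:: c, c' & s] | key d == i) A d)%N (xs i))
     | i <- drop (key c).+1 (enum 'I_n)] =
   [seq flatten (nseq (\sum_(d <- c' :: s | key d == i) A d)%N (xs i))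
     | i <- drop (key c).+1 (enum 'I_n)].
  apply/eq_in_map => i iin; rewrite big_cons ifN //.
  by apply/eqP => E; move: kc; rewrite {1}E iin.
move/andP: pth => [cc' pth].
transitivity (flatten (nseq (A c) (xs (key c))) ++
  flatten [seq flatten (nseq (A d) (xs (key d))) | d <- c' :: s]); first by [].
rewrite (IH c' pth).
rewrite [in RHS]drop_enum [in RHS]/= tailE big_cons eqxx.
case: (He _ _ cc') => kE.
  rewrite nseqD flatten_cat -catA -{}kE drop_enum /=.
  by [].
rewrite big_seq_cond big1 ?addn0 -?kE // => d /andP[/key_ge + /eqP dk].
by rewrite dk kE ltnn.
Qed.

Lemma wordX_keys (n : nat) (xs : 'I_n -> seq Sigma) (T : eqType) (e : rel T)
    (key : T -> 'I_n) (A : T -> nat) c s :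
  (forall c d, e c d -> key d = key c \/ key d = (key c).+1 :> nat) -> path e c s ->
  key c = 0%N :> nat ->
  flatten [seq flatten (nseq (A d) (xs (key d))) | d <- c :: s] =
  wordX xs (fun i => \sum_(d <- c :: s | key d == i) A d)%N.
Proof. by move=> He pth k0; rewrite (flatten_keys _ _ He pth) k0 drop0. Qed.

Lemma edit_path_flatten (T : eqType) (s : seq T) (P : T -> seq (edit_op Sigma))
    (f g : T -> seq Sigma) : {in s, forall d, is_edit_path (P d) (f d) (g d)} ->
  is_edit_path (flatten [seq P d | d <- s]) (flatten [seq f d | d <- s])
    (flatten [seq g d | d <- s]).
Proof.
elim: s => //= d s IH H; apply: edit_path_cat.
  by apply: H; rewrite mem_head.
by apply: IH => d' h; apply: H; rewrite inE h orbT.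
Qed.

Lemma wgt_flatten (T : Type) (s : seq T) (P : T -> seq (edit_op Sigma)) :
  wgt (flatten [seq P d | d <- s]) = (\sum_(d <- s) wgt (P d))%N.
Proof. by elim: s => [|d s IH]; rewrite ?big_nil // big_cons /= wgt_cat IH. Qed.

Lemma size_flatten_map (T : Type) (s : seq T) (P : T -> seq (edit_op Sigma)) :
  size (flatten [seq P d | d <- s]) = (\sum_(d <- s) size (P d))%N.
Proof. by elim: s => [|d s IH]; rewrite ?big_nil // big_cons /= size_cat IH. Qed.

Definition ndist (a b : nat) : nat := ((a - b) + (b - a))%N.

(** Passing through the pointwise minimum of the two exponent vectors uses only removals followed by
    additions, and both have a known cost. *)
Lemma edit_path_adjust (n : nat) (xs : 'I_n -> seq Sigma) A nu P y :
  is_edit_path P (wordX xs A) y ->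
  let D := (\sum_i ndist (A i) (nu i) * sx xs i)%N in
  exists P', [/\ is_edit_path P' (wordX xs nu) y, (wgt P' <= wgt P + D)%N &
    (size P <= size P' + D)%N].
Proof.
move=> HP D; pose mn i := minn (A i) (nu i).
have m1 i : (mn i <= A i)%N by rewrite geq_minl.
have m2 i : (mn i <= nu i)%N by rewrite geq_minr.
have [P1 [H1 w1 s1]] := edit_path_subseq (subseq_wordX xs m1) HP.
have [P2 [H2 w2 s2]] := edit_path_supseq (subseq_wordX xs m2) H1.
exists P2; split => //.
all: rewrite !size_wordX in w1 s1 w2 s2.
all: have DE : (D = (\sum_i A i * sx xs i - \sum_i mn i * sx xs i) +
       (\sum_i nu i * sx xs i - \sum_i mn i * sx xs i))%N.
  1,3: have S B : (forall i, mn i <= B i)%N ->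
      (\sum_i B i * sx xs i - \sum_i mn i * sx xs i = \sum_i (B i - mn i) * sx xs i)%N.
    1,3: move=> mB; apply/eqP; rewrite -(eqn_add2r (\sum_i mn i * sx xs i)%N).
    1,2: rewrite subnK; last by apply: leq_sum => i _; rewrite leq_mul2r mB orbT.
    1,2: by rewrite -big_split /=; apply/eqP/eq_bigr => i _; rewrite -mulnDl subnK.
  1,2: rewrite !S // -big_split /=; apply: eq_bigr => i _; rewrite -mulnDl.
  1,2: by congr (_ * _)%N; rewrite /ndist /mn; lia.
  all: rewrite DE; move: w1 s1 w2 s2; clear; lia.
Qed.

End Concatenation.

Lemma ndistR (R : realType) (a b : nat) : (ndist a b)%:R = `|a%:R - b%:R| :> R.
Proof.
rewrite /ndist natrD; have [le|lt] := leqP a b.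
  by rewrite (eqP le) add0r natrB // distrC ger0_norm // subr_ge0 ler_nat.
rewrite (eqP (ltnW lt)) addr0 natrB ?(ltnW lt) // ger0_norm // subr_ge0 ler_nat.
exact: ltnW.
Qed.

(** * Edit paths from feasible points *)

Section UpperBound.
Context (R : realType) (Sigma : eqType) (n m r : nat)
  (xs : 'I_n -> seq Sigma) (ys : 'I_m -> seq Sigma) (v : 'I_r -> 'I_m -> nat).
Hypothesis xs0 : forall i, xs i != [::].
Hypothesis ys0 : forall j, ys j != [::].

Definition cellC (c : 'I_n * 'I_m) : nat :=
  let E := size (edges (sx xs c.1) (sy ys c.2)) in
  (E * (E + sx xs c.1 + sy ys c.2))%N.

Definition cellsC : nat := (\sum_c cellC c)%N.

(** The errors, in order, of following the flow in all cells, of correcting the rows, of correcting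
    the columns, and of rounding [tau]. Neither the word nor the feasible point enters. *)
Definition liftC : nat :=
  (cellsC + (n * cellsC + (m * cellsC + \sum_j sy ys j * \sum_(s < r) v s j)))%N.

(** The sum of the coordinates increases at every step. Each cell is thus visited once, and sums
    over the set [pi] become sums along the list of its cells. *)
Lemma istep_uniq (c : 'I_n * 'I_m) s : path (@istep n m) c s -> uniq (c :: s).
Proof.
move=> pth; apply: (@map_uniq _ _ (fun c : 'I_n * 'I_m => c.1 + c.2)%N).
apply: (sorted_uniq ltn_trans ltnn).
apply: (homo_sorted (e := @istep n m)) => // {pth} a b.
case/orP => /andP[/eqP h1 /eqP h2].
  by rewrite h2 -[nat_of_ord b.1]/(val b.1) h1 addSn.
by rewrite h1 -[nat_of_ord b.2]/(val b.2) h2 addnS.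
Qed.

Lemma istep_cases1 (c d : 'I_n * 'I_m) : istep c d -> d.1 = c.1 \/ d.1 = c.1.+1 :> nat.
Proof. by case/orP => /andP[/eqP h1 /eqP h2]; [right|left]. Qed.

Lemma istep_cases2 (c d : 'I_n * 'I_m) : istep c d -> d.2 = c.2 \/ d.2 = c.2.+1 :> nat.
Proof. by case/orP => /andP[/eqP h1 /eqP h2]; [left|right]. Qed.

Lemma LP_edit_path nu pi f tau lam :
  let N := (\sum_i nu i * sx xs i)%N in
  (0 < N)%N -> is_interleaving pi ->
  LP_feasible xs ys v (dir R xs nu) pi f tau lam ->
  exists (t : 'I_r -> nat) P,
    [/\ is_edit_path P (wordX xs nu) (wordX ys (fun j => \sum_(s < r) t s * v s j)%N),
    (wgt P)%:R <= N%:R / lam * LP_obj xs ys f pi + liftC%:R &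
    N%:R / lam - liftC%:R <= (size P)%:R].
Proof.
move=> N N0 [c0 [s [[c01 c02] pth _ _ piE]]] [[f0 tau0 /andP[lam0 lam1]] f1 cons row col].
(* At this scale the row constraint reads off the word itself: the content of row [i] becomes the
   length of its [i]-th block, because the direction divides by [N]. *)
pose M : R := N%:R / lam.
have M0 : 0 <= M by rewrite divr_ge0 // ltW.
pose cs := c0 :: s.
have ucs : uniq cs := istep_uniq pth.
have pics c : (c \in pi) = (c \in cs) by rewrite piE finset.in_set.
have big_pi (P : pred ('I_n * 'I_m)) (F : 'I_n * 'I_m -> R) :
    \sum_(c <- cs | P c) F c = \sum_(c in pi | P c) F c.
  by rewrite big_mkcond big_uniq //= -big_mkcondr; apply: eq_bigl => c; rewrite pics.
have big_pi' (F : 'I_n * 'I_m -> R) : \sum_(c <- cs) F c = \sum_(c in pi) F c.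
  by rewrite big_uniq //=; apply: eq_bigl => c; rewrite pics.
pose ax c := \sum_(e <- edges (sx xs c.1) (sy ys c.2)) M * f c e * (ind_x e)%:R.
pose ay c := \sum_(e <- edges (sx xs c.1) (sy ys c.2)) M * f c e * (ind_y e)%:R.
pose aw c := \sum_(e <- edges (sx xs c.1) (sy ys c.2))
   M * f c e * (ecost (xs c.1) (ys c.2) e)%:R.
pose az c := \sum_(e <- edges (sx xs c.1) (sy ys c.2)) M * f c e.
have /choice[ABP ABPok] : forall c, exists ABP : nat * nat * seq (edit_op Sigma),
   c \in pi -> [/\ is_edit_path ABP.2 (flatten (nseq ABP.1.1 (xs c.1)))
      (flatten (nseq ABP.1.2 (ys c.2))),
      `|(ABP.1.1 * sx xs c.1)%:R - ax c| <= (cellC c)%:R,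
      `|(ABP.1.2 * sy ys c.2)%:R - ay c| <= (cellC c)%:R,
      (wgt ABP.2)%:R <= aw c + (cellC c)%:R & az c - (cellC c)%:R <= (size ABP.2)%:R].
  move=> c; have [cpi|_] := boolP (c \in pi); last by exists (0%N, 0%N, [::]).
  have [e|w wv|A [B [P H]]] :=
    @near_path_circulation R _ _ _ (xs0 c.1) (ys0 c.2) (fun e => M * f c e).
  - by rewrite mulr_ge0.
  - by rewrite -!mulr_sumr; congr (_ * _); exact: cons.
  by exists (A, B, P).
pose A c := (ABP c).1.1; pose B c := (ABP c).1.2; pose P c := (ABP c).2.
pose P0 := flatten [seq P c | c <- cs].
pose An i := (\sum_(d <- cs | d.1 == i) A d)%N.
pose Bn j := (\sum_(d <- cs | d.2 == j) B d)%N.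
have csP c : c \in cs -> c \in pi by rewrite pics.
have H0 : is_edit_path P0 (wordX xs An) (wordX ys Bn).
  rewrite /An -(wordX_keys _ _ istep_cases1 pth c01).
  rewrite /Bn -(wordX_keys _ _ istep_cases2 pth c02).
  by apply: edit_path_flatten => c /csP /ABPok[].
have sumC (Q : pred ('I_n * 'I_m)) : (\sum_(c <- cs | Q c) (cellC c)%:R : R) <= cellsC%:R.
  rewrite -natr_sum ler_nat /cellsC [X in (_ <= X)%N](bigID (mem cs)) /=.
  apply: leq_trans (leq_addr _ _); rewrite big_mkcond big_uniq //= -big_mkcondr.
  rewrite [X in (_ <= X)%N](bigID Q) /=; exact: leq_addr.
have sumC' : (\sum_(c <- cs) (cellC c)%:R : R) <= cellsC%:R by exact: (sumC predT).
have w0 : (wgt P0)%:R <= M * LP_obj xs ys f pi + cellsC%:R.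
  rewrite wgt_flatten natr_sum.
  apply: (@le_trans _ _ (\sum_(c <- cs) (aw c + (cellC c)%:R))).
    by rewrite big_seq [leRHS]big_seq; apply: ler_sum => c /csP /ABPok[].
  rewrite big_split /=; apply: lerD => //.
  rewrite le_eqVlt; apply/orP; left; apply/eqP.
  rewrite big_pi' /LP_obj mulr_sumr; apply: eq_bigr => c _.
  by rewrite mulr_sumr; apply: eq_bigr => e _; rewrite mulrA.
have s0 : M - cellsC%:R <= (size P0)%:R.
  rewrite size_flatten_map natr_sum.
  apply: (@le_trans _ _ (\sum_(c <- cs) (az c - (cellC c)%:R))); last first.
    by rewrite big_seq [leRHS]big_seq; apply: ler_sum => c /csP /ABPok[].
  rewrite sumrB; apply: lerB => //.
  rewrite le_eqVlt; apply/orP; left; apply/eqP.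
  rewrite big_pi' -[LHS]mulr1 -f1 mulr_sumr; apply: eq_bigr => c _.
  by rewrite mulr_sumr.
have sumdist (Q : pred ('I_n * 'I_m)) (F G : 'I_n * 'I_m -> R) :
    {in cs, forall c, Q c -> `|F c - G c| <= (cellC c)%:R} ->
    `|\sum_(c <- cs | Q c) F c - \sum_(c <- cs | Q c) G c| <= cellsC%:R.
  move=> FG; rewrite -sumrB; apply: le_trans (ler_norm_sum _ _ _) _.
  apply: le_trans (sumC Q); rewrite big_seq_cond [leRHS]big_seq_cond.
  by apply: ler_sum => c /andP[cc Qc]; exact: FG.
have lam_neq : lam != 0 by rewrite gt_eqF.
have N_neq : N%:R != 0 :> R by rewrite pnatr_eq0 -lt0n.
have distX i : (ndist (An i) (nu i) * sx xs i)%:R <= cellsC%:R :> R.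
  rewrite natrM ndistR -[X in _ * X]ger0_norm // -normrM mulrBl -!natrM.
  have -> : (An i * sx xs i)%:R = \sum_(c <- cs | c.1 == i) (A c * sx xs c.1)%:R :> R.
    by rewrite /An big_distrl /= natr_sum; apply: eq_bigr => c /eqP ->.
  have -> : (nu i * sx xs i)%:R = \sum_(c <- cs | c.1 == i) ax c.
    rewrite big_pi; have := congr1 (fun z => M * z) (row i); rewrite mulr_sumr.
    under eq_bigr => c _ do rewrite mulr_sumr.
    under eq_bigr => c _ do under eq_bigr => e _ do rewrite mulrA.
    move=> ->; rewrite /dir mxE /M -/N natrM -/(sx xs i).
    by field; rewrite lam_neq N_neq.
  by apply: sumdist => c /csP /ABPok[].
(* Rounding the coefficients keeps [mu] in the linear set; rounding the column exponents themselves
   could leave it. Each period vector is lost at most once. *)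
pose t s' := Num.truncn (M * tau s').
have tP s' : (t s')%:R <= M * tau s' < (t s').+1%:R.
  by apply: truncn_itv; rewrite mulr_ge0.
pose mu j := (\sum_(s < r) t s * v s j)%N.
have distY j : (ndist (Bn j) (mu j) * sy ys j)%:R <=
    cellsC%:R + (sy ys j * \sum_(s < r) v s j)%:R :> R.
  rewrite natrM ndistR -[X in _ * X]ger0_norm // -normrM mulrBl -!natrM.
  have -> : (Bn j * sy ys j)%:R = \sum_(c <- cs | c.2 == j) (B c * sy ys c.2)%:R :> R.
    by rewrite /Bn big_distrl /= natr_sum; apply: eq_bigr => c /eqP ->.
  apply: le_trans (ler_distD (\sum_(c <- cs | c.2 == j) ay c) _ _) _.
  apply: lerD; first by apply: sumdist => c /csP /ABPok[].
  have -> : \sum_(c <- cs | c.2 == j) ay c =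
      (sy ys j)%:R * \sum_(s < r) (M * tau s) * (v s j)%:R.
    rewrite big_pi; have := congr1 (fun z => M * z) (col j); rewrite mulr_sumr.
    under eq_bigr => c _ do rewrite mulr_sumr.
    under eq_bigr => c _ do under eq_bigr => e _ do rewrite mulrA.
    move=> ->; rewrite -/(sy ys j) mulrCA; congr (_ * _).
    by rewrite mulr_sumr; apply: eq_bigr => s' _; rewrite mulrA.
  rewrite natrM [(mu j)%:R * _]mulrC -mulrBr normrM ger0_norm // natrM ler_wpM2l //.
  rewrite /mu !natr_sum -sumrB; apply: le_trans (ler_norm_sum _ _ _) _.
  apply: ler_sum => s' _; have /andP[t1 t2] := tP s'.
  rewrite natrM -mulrBl normrM [`|(v s' j)%:R|]ger0_norm // ler_piMl //.
  by rewrite ger0_norm ?subr_ge0 // lerBlDl natr1 ltW.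
have [P1 [H1 w1 s1]] := edit_path_adjust nu H0.
have [P2 [H2 w2 s2]] := edit_path_adjust mu (eswap_edit_path H1).
exists t, (eswap P2); split; first exact: eswap_edit_path.
all: rewrite ?wgt_eswap ?size_eswap in w2 s2 *.
all: have DX : (\sum_i ndist (An i) (nu i) * sx xs i)%:R <= (n * cellsC)%:R :> R.
  1,3: rewrite natr_sum; apply: le_trans (ler_sum _ (fun i _ => distX i)) _.
  1,2: by rewrite big_const_ord iter_addr addr0 natrM mulr_natl.
all: have DY : (\sum_j ndist (Bn j) (mu j) * sy ys j)%:R <=
    (m * cellsC)%:R + (\sum_j sy ys j * \sum_(s < r) v s j)%:R :> R.
  1,3: rewrite [leLHS]natr_sum; apply: le_trans (ler_sum _ (fun j _ => distY j)) _.
  1,2: by rewrite big_split /= big_const_ord iter_addr addr0 natrM mulr_natl natr_sum.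
all: rewrite -/M /liftC !natrD.
all: move: w1 s1 w2 s2; rewrite -!(ler_nat R) !natrD; move: w0 s0 DX DY; clear; lra.
Qed.

End UpperBound.

(** The difference of the two ratios is [D * (s + w) / (s * (s - D))], which is at most
    [2 * D / (s - D)]; [s - D] is at least half of [s], which gives [4 * e]. *)
Lemma ratio_perturb (R : realType) (w s D e : R) : 0 <= w -> w <= s -> 0 < s ->
  0 <= D -> D <= e * s -> e <= 1 / 2 ->
  D < s /\ (w + D) / (s - D) <= w / s + 4 * e.
Proof.
move=> w0 ws s0 D0 De e2.
have e0 : 0 <= e by rewrite -(pmulr_lge0 _ s0); exact: le_trans De.
have es : e * s <= 1 / 2 * s by rewrite ler_wpM2r // ltW.
have Ds : D < s by lra.
split => //; rewrite ler_pdivrMr ?subr_gt0 //.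
have [rho0 rho1] : 0 <= w / s /\ w / s <= 1.
  by split; [rewrite divr_ge0 // ltW|rewrite ler_pdivrMr // mul1r].
have wE : w = w / s * s by rewrite divfK // gt_eqF.
rewrite {1}wE; move: (w / s) rho0 rho1 => rho rho0 rho1.
have h1 : D * rho <= D by rewrite ler_piMr.
have h2 : D * e <= D * (1 / 2) by rewrite ler_wpM2l.
nra.
Qed.

Lemma sup_ge0 (R : realType) (E : set R) : (forall x, E x -> 0 <= x) -> 0 <= sup E.
Proof.
move=> E0; have [[[x Ex] ubE]|/sup_out ->//] := pselect (has_sup E).
exact: le_trans (E0 x Ex) (ub_le_sup ubE Ex).
Qed.

(** The bound [0 <= b] serves the empty set, whose [sup] is 0. This occurs when [X] contains only
    the empty word: [DX] and the sets of long words are then empty. *)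
Lemma sup_le_ge0 (R : realType) (E : set R) b :
  (forall x, E x -> x <= b) -> 0 <= b -> sup E <= b.
Proof.
move=> Eb b0; have [->|/set0P[x Ex]] := eqVneq E set0; first by rewrite sup0.
by apply: ge_sup => //; exists x.
Qed.

(** * The limit *)

Section NormalizedDistance.
Context (R : realType) (Sigma : eqType).
Implicit Types (x y : seq Sigma) (P : seq (edit_op Sigma)).

Lemma edit_path_ex x y : exists P, is_edit_path P x y.
Proof.
have nil : @is_edit_path Sigma [::] [::] [::] by [].
have [P1 [H1 _ _]] := edit_path_supseq (sub0seq x) nil.
have [P2 [H2 _ _]] := edit_path_supseq (sub0seq y) (eswap_edit_path H1).
by exists (eswap P2); exact: eswap_edit_path.
Qed.

Lemma edit_path_size P x y : is_edit_path P x y -> (size x <= size P)%N.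
Proof. by case=> _ [<- _]; rewrite size_pmap (leq_trans (count_size _ _)) // size_map. Qed.

Lemma ned_ge0 x y : 0 <= ned R x y.
Proof.
rewrite /ned; case: ifP => // _; apply: inf_ge0 => _ [P _ <-].
by rewrite divr_ge0.
Qed.

Lemma ned_le P x y : x != [::] -> is_edit_path P x y ->
  ned R x y <= (wgt P)%:R / (size P)%:R.
Proof.
move=> x0 HP; rewrite /ned (negbTE x0) /=; apply: ge_inf; last by exists P.
by exists 0 => _ [Q _ <-]; rewrite divr_ge0.
Qed.

Lemma ned_le1 x y : ned R x y <= 1.
Proof.
have [->|x0] := eqVneq x [::].
  have [->|y0] := eqVneq y [::]; first by rewrite /ned eqxx.
  rewrite /ned (negbTE y0) andbF.
  have [P HP] := edit_path_ex [::] y.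
  apply: (@le_trans _ _ ((wgt P)%:R / (size P)%:R)).
    apply: ge_inf; last by exists P.
    by exists 0 => _ [Q _ <-]; rewrite divr_ge0.
  have [->|s0] := eqVneq (size P) 0%N; first by rewrite invr0 mulr0.
  by rewrite ler_pdivrMr ?ltr0n ?lt0n // mul1r ler_nat wgt_size.
have [P HP] := edit_path_ex x y; apply: le_trans (ned_le x0 HP) _.
have [->|s0] := eqVneq (size P) 0%N; first by rewrite invr0 mulr0.
by rewrite ler_pdivrMr ?ltr0n ?lt0n // mul1r ler_nat wgt_size.
Qed.

Lemma le_ned (b : R) x y : x != [::] ->
  (forall P, is_edit_path P x y -> b <= (wgt P)%:R / (size P)%:R) -> b <= ned R x y.
Proof.
move=> x0 H; rewrite /ned (negbTE x0) /=; have [P HP] := edit_path_ex x y.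
apply: lb_le_inf; first by exists ((wgt P)%:R / (size P)%:R), P.
by move=> _ [Q HQ <-]; exact: H.
Qed.

End NormalizedDistance.

(** * The two estimates for long words and their common limit *)

Section Limit.
Context (R : realType) (Sigma : eqType) (n m k r : nat)
  (xs : 'I_n -> seq Sigma) (ys : 'I_m -> seq Sigma) (X Y : set (seq Sigma))
  (u : 'I_k -> 'I_n -> nat) (v : 'I_r -> 'I_m -> nat).
Hypothesis n0 : (0 < n)%N.
Hypothesis m0 : (0 < m)%N.
Hypothesis xs0 : forall i, xs i != [::].
Hypothesis ys0 : forall j, ys j != [::].
Hypothesis XE : forall w, X w -> exists nu, w = wordX xs nu.
Hypothesis YE : forall w, Y w -> exists mu, w = wordX ys mu.
Hypothesis SXE : SX xs X = linset u.
Hypothesis SYE : SX ys Y = linset v.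

Let F (a : 'rV[R^o]_n) : R := Fmin xs ys v a.
Let dist (x : seq Sigma) : R := inf [set ned R x y | y in Y].

(** Cutting the empty path between the words with zero exponents already produces an
    interleaving. *)
Lemma interleaving_ex : exists pi : {set 'I_n * 'I_m}, is_interleaving pi.
Proof.
have w0 (l : nat) (zs : 'I_l -> seq Sigma) : wordX zs (fun=> 0%N) = [::].
  by apply/eqP; rewrite -size_eq0 size_wordX big1.
have H : is_edit_path [::] (wordX xs (fun=> 0%N)) (wordX ys (fun=> 0%N)).
  by rewrite !w0.
by have [pi [Z [piI _ _ _ _]]] := closed_cells R xs0 ys0 n0 m0 H; exists pi.
Qed.

Lemma Fmin_ge0 a : 0 <= F a.
Proof. by apply: inf_ge0 => _ [pi _ <-]; exact: OPT_ge0. Qed.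

Definition direction (a : 'rV[R^o]_n) : Prop :=
  (forall i, 0 <= a ord0 i) /\ \sum_i (sx xs i)%:R * a ord0 i = 1.

Lemma Fmin_le1 a : direction a -> F a <= 1.
Proof.
move=> [a0 a1]; have [pi piI] := interleaving_ex.
have [f [tau [lam feas]]] := LP_feasible_ex v xs0 ys0 piI a0 a1.
apply: le_trans (Fmin_le piI feas) _.
by have /andP[] := LP_obj_bounds feas.
Qed.

(** Half of [e] is spent on the infimum over the interleavings and half on the infimum over the
    feasible points; both sets are nonempty, so their infima are approached. *)
Lemma Fmin_approx a (e : R) : direction a -> 0 < e ->
  exists pi f tau lam, [/\ is_interleaving pi, LP_feasible xs ys v a pi f tau lam &
    LP_obj xs ys f pi < F a + e].
Proof.
move=> [a0 a1] e0; have e2 : 0 < e / 2 by rewrite divr_gt0.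
have hF : has_inf [set OPT xs ys v a pi | pi in [set pi | is_interleaving pi]].
  split; last by exists 0 => _ [pi _ <-]; exact: OPT_ge0.
  by have [pi piI] := interleaving_ex; exists (OPT xs ys v a pi), pi.
have [_ [pi piI <-] lt1] := inf_adherent e2 hF.
have hO : has_inf [set LP_obj xs ys f pi | f in
    [set f | exists tau lam, LP_feasible xs ys v a pi f tau lam]].
  split; last by exists 0 => _ [f [tau [lam /LP_obj_bounds /andP[? _]]] <-].
  have [f [tau [lam feas]]] := LP_feasible_ex v xs0 ys0 piI a0 a1.
  by exists (LP_obj xs ys f pi), f => //; exists tau, lam.
have [_ [f [tau [lam feas]] <-] lt2] := inf_adherent e2 hO.
exists pi, f, tau, lam; split => //.
rewrite -/(OPT xs ys v a pi) in lt2; rewrite -/(F a) in lt1; lra.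
Qed.

Lemma wordX_eq0 nu : (wordX xs nu == [::]) = (nu == (fun=> 0%N)).
Proof.
rewrite -size_eq0 size_wordX sum_nat_eq0; apply/forallP/eqP => [H|-> i]; last by [].
apply/funext => i; apply/eqP; have := H i; rewrite /= muln_eq0.
by rewrite [sx xs i == 0%N]eqn0Ngt sx_gt0 // orbF.
Qed.

Lemma dir_direction nu : nu != (fun=> 0%N) -> direction (dir R xs nu).
Proof.
move=> nu0; have N0 : (0 < \sum_(i < n) nu i * size (xs i))%N.
  by rewrite -wordX_eq0 -size_eq0 size_wordX -lt0n in nu0.
split=> [i|]; first by rewrite mxE divr_ge0.
under eq_bigr => i _ do rewrite mxE mulrA.
rewrite -mulr_suml; under eq_bigr => i _ do rewrite -natrM mulnC.
by rewrite -natr_sum divff // pnatr_eq0 -lt0n.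
Qed.

Lemma DX_approx a (e : R) : DX xs X a -> 0 < e ->
  exists nu, [/\ SX xs X nu, nu != (fun=> 0%N) &
    forall i, `|a ord0 i - dir R xs nu ord0 i| < e].
Proof.
move=> aD e0; have [_ [[nu [nuS nu0] <-] ab]] := aD _ (nbhsx_ballx a e e0).
exists nu; split => // i.
by move: ab; rewrite /ball /= => -[_ /(_ ord0 i)].
Qed.

(** Both conditions are closed and hold for the directions of words, of which [DX] is the
    closure. *)
Lemma DX_direction a : DX xs X a -> direction a.
Proof.
move=> aD; split=> [i|].
  apply/ler_addgt0Pr => e e0; have [nu [_ nu0 ae]] := DX_approx aD e0.
  have [d0 _] := dir_direction nu0; have := d0 i; have := ae i.
  by rewrite ltr_norml => /andP[? ?] ?; lra.
apply/eqP; rewrite -subr_eq0 -normr_le0; apply/ler_addgt0Pr => e e0; rewrite add0r.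
have L0 : 0 < (lenX xs).+1%:R :> R by rewrite ltr0n.
have [nu [_ nu0 ae]] := DX_approx aD (divr_gt0 e0 L0).
have [_ d1] := dir_direction nu0.
rewrite -[X in _ - X]d1 -sumrB; apply: le_trans (ler_norm_sum _ _ _) _.
apply: (@le_trans _ _ (\sum_i (sx xs i)%:R * (e / (lenX xs).+1%:R))).
  apply: ler_sum => i _; rewrite -mulrBr normrM ger0_norm // ler_wpM2l //.
  exact: ltW.
rewrite -mulr_suml -natr_sum -/(lenX xs) mulrCA ler_piMr ?(ltW e0) //.
by rewrite ler_pdivrMr // mul1r ler_nat.
Qed.

(** Zero coefficients put the empty word into [Y], so [dist] is an infimum over a nonempty set and
    can be bounded from below. *)
Lemma Y_nonempty : Y !=set0.
Proof.
exists (wordX ys (fun=> 0%N)); have : SX ys Y (fun=> 0%N) by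
  rewrite SYE; exists (fun=> 0%N) => j; rewrite big1.
by [].
Qed.

Lemma dist_ge0 x : 0 <= dist x.
Proof. by apply: inf_ge0 => _ [y _ <-]; exact: ned_ge0. Qed.

Lemma dist_le x y : Y y -> dist x <= ned R x y.
Proof.
move=> Yy; apply: ge_inf; last by exists y.
by exists 0 => _ [z _ <-]; exact: ned_ge0.
Qed.

Lemma dist_le1 x : dist x <= 1.
Proof. by have [y Yy] := Y_nonempty; apply: le_trans (dist_le x Yy) (ned_le1 _ _ _). Qed.

Let tail_sup (K : nat) : R := sup [set dist x | x in [set x | X x /\ (K <= size x)%N]].

Lemma dist_tail_sup K x : X x -> (K <= size x)%N -> dist x <= tail_sup K.
Proof.
move=> Xx Kx; apply: ub_le_sup; last by exists x.
by exists 1 => _ [z _ <-]; exact: dist_le1.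
Qed.

(* The closure point [a] is approached by directions of words of [X], which
   repeating their exponent vectors makes as long as needed. *)
Lemma Fmin_le_tail_sup K a : DX xs X a -> F a <= tail_sup K.
Proof.
move=> aD; have [a0 a1] := DX_direction aD.
apply/ler_addgt0Pr => e0 e00.
(* The bound [1 / 2] is the range of [ratio_perturb], and [e0 / 4] absorbs its factor 4. *)
pose e : R := Num.min (e0 / 4) (1 / 2).
have e_gt0 : 0 < e by rewrite lt_min !divr_gt0.
have e_le : e <= 1 / 2 by rewrite ge_min lexx orbT.
have e4 : 4 * e <= e0.
  have : e <= e0 / 4 by rewrite ge_min lexx.
  by lra.
pose L : R := (lenX xs).+1%:R.
have L0 : 0 < L by rewrite ltr0n.
(* In [D] the deviations are weighted by lengths of total less than [L] and then doubled, so they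
   contribute at most [2 * L * N * del = e / 2 * N]. *)
pose del := e / (4 * L).
have del0 : 0 < del by rewrite divr_gt0 // mulr_gt0.
have [nu [nuS nu0 ad]] := DX_approx aD del0.
pose C : R := (pathC xs ys)%:R.
have C0 : 0 <= C by [].
(* The repeated word has length [N] at least [t]. The second argument makes [C] at most [e / 2 * N],
   the other half of the allowed error; the first puts the word into the tail. *)
pose t := maxn K (Num.truncn (2 * C / e)).+1.
have t2 : 2 * C / e <= t%:R.
  have /andP[_ h] : _ <= 2 * C / e < _ := truncn_itv (divr_ge0 (mulr_ge0 (ler0n _ 2) C0) (ltW e_gt0)).
  by apply: le_trans (ltW h) _; rewrite ler_nat leq_maxr.
pose nu' i := (t * nu i)%N.
have Xx : X (wordX xs nu').
  suff : SX xs X nu' by [].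
  move: nuS; rewrite SXE => -[q qE]; exists (fun s => t * q s)%N => i.
  by rewrite /nu' qE big_distrr /=; apply: eq_bigr => s _; rewrite mulnA.
have N0 : (0 < \sum_i nu i * sx xs i)%N.
  by rewrite -wordX_eq0 -size_eq0 size_wordX -lt0n in nu0.
have sxE : size (wordX xs nu') = (t * \sum_i nu i * sx xs i)%N.
  by rewrite size_wordX big_distrr /=; apply: eq_bigr => i _; rewrite mulnA.
have t_gt0 : (0 < t)%N by rewrite leq_max orbT.
have tx : (t <= size (wordX xs nu'))%N by rewrite sxE leq_pmulr.
have Kx : (K <= size (wordX xs nu'))%N by apply: leq_trans tx; rewrite leq_maxl.
have x0 : wordX xs nu' != [::] by rewrite -size_eq0 -lt0n (leq_trans t_gt0).
pose N : R := (size (wordX xs nu'))%:R.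
have N_gt0 : 0 < N by rewrite ltr0n (leq_trans t_gt0).
have CN : C <= e / 2 * N.
  have h : 2 * C / e <= N by apply: le_trans t2 _; rewrite ler_nat.
  by move: h; rewrite ler_pdivrMr // => h; nra.
pose D : R := 2 * (\sum_i (sx xs i)%:R * `|N * a ord0 i - (nu' i)%:R|) + C.
have D0 : 0 <= D.
  by rewrite addr_ge0 // mulr_ge0 // sumr_ge0 // => i _; rewrite mulr_ge0.
have DN : D <= e * N.
  suff : \sum_i (sx xs i)%:R * `|N * a ord0 i - (nu' i)%:R| <= e / 4 * N.
    by rewrite /D; lra.
  apply: (@le_trans _ _ (\sum_i (sx xs i)%:R * (N * del))).
    apply: ler_sum => i _; rewrite ler_wpM2l //.
    have -> : (nu' i)%:R = N * dir R xs nu ord0 i.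
      rewrite mxE /N sxE /nu' !natrM.
      set Q := (\sum_i nu i * sx xs i)%N in N0 *.
      by field; rewrite pnatr_eq0 -lt0n.
    by rewrite -mulrBr normrM (ger0_norm (ltW N_gt0)) ler_wpM2l ?ltW.
  rewrite -mulr_suml -natr_sum -/(lenX xs).
  have le1 : (lenX xs)%:R <= L by rewrite ler_nat.
  apply: (@le_trans _ _ (L * (N * del))).
    by rewrite ler_wpM2r // mulr_ge0 // ltW.
  rewrite /del le_eqVlt; apply/orP; left; apply/eqP; field.
  by rewrite gt_eqF.
apply: (@le_trans _ _ (dist (wordX xs nu') + e0)); last first.
  by rewrite lerD2r; exact: dist_tail_sup.
rewrite -lerBlDr; apply: lb_le_inf.
  by have [y Yy] := Y_nonempty; exists (ned R (wordX xs nu') y), y.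
move=> _ [y Yy <-]; have [mu yE] := YE Yy; rewrite yE.
have [q qE] : linset v mu by rewrite -SYE /SX /= -yE.
apply: le_ned => // P HP.
have sP : N <= (size P)%:R by rewrite ler_nat; exact: edit_path_size HP.
have s_gt0 : 0 < (size P)%:R :> R by apply: lt_le_trans sP.
have Ds : D <= e * (size P)%:R.
  by apply: le_trans DN _; rewrite ler_wpM2l // ltW.
have wP : (wgt P)%:R <= (size P)%:R :> R by rewrite ler_nat wgt_size.
have [lt le] := ratio_perturb (ler0n _ (wgt P)) wP s_gt0 D0 Ds e_le.
have := Fmin_le_path xs0 ys0 n0 m0 HP qE a0 a1 N_gt0 lt.
rewrite -/(F a) => h; have := le_trans h le; lra.
Qed.

Lemma dist_le_Fmin nu : SX xs X nu -> nu != (fun=> 0%N) ->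
  dist (wordX xs nu) <= F (dir R xs nu) + 4 * ((liftC xs ys v)%:R / (size (wordX xs nu))%:R).
Proof.
move=> nuS nu0; set C : R := (liftC xs ys v)%:R; set N : R := (size _)%:R.
have C0 : 0 <= C by [].
have Nn0 : (0 < \sum_i nu i * sx xs i)%N.
  by rewrite -wordX_eq0 -size_eq0 size_wordX -lt0n in nu0.
have N_gt0 : 0 < N by rewrite ltr0n size_wordX.
(* For a short word the error term alone exceeds 2, while distances are at most 1; otherwise
   [ratio_perturb] applies with [C / N]. *)
have [big|small] := ltP (1 / 2) (C / N).
  by have := dist_le1 (wordX xs nu); have := Fmin_ge0 (dir R xs nu); lra.
apply/ler_addgt0Pr => e e0.
have [pi [f [tau [lam [piI feas obj]]]]] := Fmin_approx (dir_direction nu0) e0.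
have [t [P [HP wP sP]]] := LP_edit_path xs0 ys0 Nn0 piI feas.
have /andP[lam0 lam1] : 0 < lam <= 1 by case: feas => -[].
rewrite -size_wordX -/N -/C in wP sP; set M := N / lam in wP sP.
have NM : N <= M by rewrite ler_pdivlMr // ler_piMr // ltW.
have M0 : 0 < M by apply: lt_le_trans NM.
have /andP[ o0 o1] := LP_obj_bounds feas.
set mu := (fun j => _) in HP.
have Yy : Y (wordX ys mu).
  suff : SX ys Y mu by [].
  by rewrite SYE; exists t.
apply: le_trans (dist_le _ Yy) _.
have x0 : wordX xs nu != [::] by rewrite wordX_eq0.
apply: le_trans (ned_le R x0 HP) _.
(* Since [lam <= 1], [M] is at least [N], and the error relative to [M] is no larger than relative
   to [N]. *)
have CM : C <= C / N * M.
  by rewrite mulrAC ler_pdivlMr // ler_wpM2l.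
have Mo : M * LP_obj xs ys f pi <= M by rewrite ler_piMr // ltW.
have Mo0 : 0 <= M * LP_obj xs ys f pi by rewrite mulr_ge0 // ltW.
have [lt le] := ratio_perturb Mo0 Mo M0 C0 CM small.
have q : (wgt P)%:R / (size P)%:R <= (M * LP_obj xs ys f pi + C) / (M - C).
  by apply: ler_div2; rewrite ?subr_gt0.
apply: le_trans q (le_trans le _).
rewrite mulrAC divff ?gt_eqF // mul1r; lra.
Qed.

Let S : R := sup [set F a | a in DX xs X].

Lemma Fmin_sup_le K : S <= tail_sup K.
Proof.
apply: sup_le_ge0; first by move=> _ [a aD <-]; exact: Fmin_le_tail_sup.
by apply: sup_ge0 => _ [x _ <-]; exact: dist_ge0.
Qed.

(** [0 < K] excludes the empty word, which has no direction. For every other word of [X] the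
    direction of its exponents lies in [DX], even before taking the closure. *)
Lemma tail_sup_le K : (0 < K)%N -> tail_sup K <= S + 4 * (liftC xs ys v)%:R / K%:R.
Proof.
move=> K0; have KR : 0 < K%:R :> R by rewrite ltr0n.
have S0 : 0 <= S by apply: sup_ge0 => _ [a _ <-]; exact: Fmin_ge0.
apply: sup_le_ge0; last by rewrite addr_ge0 // divr_ge0 // mulr_ge0.
move=> _ [x [Xx Kx] <-]; have [nu xE] := XE Xx; rewrite {}xE in Xx Kx *.
have nu0 : nu != (fun=> 0%N).
  by rewrite -wordX_eq0 -size_eq0 -lt0n (leq_trans K0).
apply: le_trans (dist_le_Fmin Xx nu0) _; apply: lerD.
  apply: ub_le_sup; last first.
    by exists (dir R xs nu) => //; apply: subset_closure; exists nu.
  by exists 1 => _ [a /DX_direction aD <-]; exact: Fmin_le1.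
rewrite mulrA ler_wpM2l ?mulr_ge0 // lef_pV2 ?posrE ?ler_nat //.
by rewrite ltr0n (leq_trans K0).
Qed.

Lemma AH_ned_sup_Fmin : AH_ned R X Y = S.
Proof.
rewrite /AH_ned; apply: (@cvg_lim R^o); first exact: Rhausdorff.
(* [harmonic K] is [1 / (K + 1)], and [1 / K <= 2 / (K + 1)] once [K >= 1]; this doubles the
   constant 4. *)
pose C : R := 8 * (liftC xs ys v)%:R.
apply: (@squeeze_cvgr _ _ _ _ (fun=> S) (fun K => S + C * harmonic K)).
- near=> K; have K0 : (0 < K)%N by near: K; exact: nbhs_infty_ge.
  rewrite Fmin_sup_le /=; apply: le_trans (tail_sup_le K0) _; rewrite lerD2l.
  have L0 : 0 <= (liftC xs ys v)%:R :> R by [].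
  have KR : 1 <= K%:R :> R by rewrite ler1n.
  have h : 1 / 2 <= K.+1%:R^-1 * K%:R :> R.
    by rewrite [X in _ <= X]mulrC ler_pdivlMr ?ltr0n // -(natr1 K); lra.
  rewrite ler_pdivrMr ?(lt_le_trans ltr01) // /C -!mulrA.
  by move: (_^-1 * _) (ler_wpM2l L0 h) => z; lra.
- exact: (@cvg_cst R^o).
- rewrite -[X in _ --> X]addr0 -[X in _ + X](mulr0 C).
  apply: (@cvgD R R^o); first exact: (@cvg_cst R^o).
  by apply: cvgMr; exact: cvg_harmonic.
Unshelve. all: by end_near.
Qed.

End Limit.

Theorem mainTheorem18 (R : realType) (Sigma : finType) (n m k r : nat)
  (xs : 'I_n -> seq Sigma) (ys : 'I_m -> seq Sigma)
  (X Y : set (seq Sigma))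
  (u : 'I_k -> 'I_n -> nat) (v : 'I_r -> 'I_m -> nat) :
  (0 < n)%N -> (0 < m)%N ->
  (forall i, xs i != [::]) -> (forall j, ys j != [::]) ->
  context_free X -> context_free Y ->
  (forall w, X w -> exists nu, w = wordX xs nu) ->
  (forall w, Y w -> exists mu, w = wordX ys mu) ->
  SX xs X = linset u -> SX ys Y = linset v ->
  stratified u -> stratified v ->
  AH_ned R X Y = sup [set Fmin (R:=R) xs ys v a | a in DX (R:=R) xs X].
Proof.
move=> n0 m0 xs0 ys0 _ _ XE YE SXE SYE _ _.
exact: (AH_ned_sup_Fmin R n0 m0 xs0 ys0 XE YE SXE SYE).
Qed.
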